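(* Let $f:\mathbb{A}\to\mathbb{A}$ be a negative-torsion map of the annulus $\mathbb{A}=\mathbb{T}\times\mathbb{R}$. Let $\gamma:\mathbb{T}\to\mathbb{A}$ be a $\mathcal{C}^1$ $f$-invariant essential curve such that the restricted dynamics $f_{|\gamma}$ is non-wandering. Then $\gamma$ is the graph of a $\mathcal{C}^1$ function, i.e. there is a $\mathcal{C}^1$ function $\psi:\mathbb{T}\to\mathbb{R}$ with $\gamma(\mathbb{T})=\{(x,\psi(x)):x\in\mathbb{T}\}$.
   Context: $\mathbb{T}=\mathbb{R}/\mathbb{Z}$, $\mathbb{A}=\mathbb{T}\times\mathbb{R}$ with the standard Riemannian metric and the standard trivialization of its tangent bundle ($T_x\mathbb{A}\cong\mathbb{R}^2$), with the counterclockwise orientation. $\chi=(0,1)$ is the unit positive vertical vector. For non-zero vectors $u,v\in\mathbb{R}^2$, $\theta(u,v)\in\mathbb{T}$ is the oriented angle from $u$ to $v$, measured in turns (a full counterclockwise turn is $1$). An isotopy is an arc in $\mathrm{Diff}^1(\mathbb{A})$ continuous for the compact-open (weak) $\mathcal{C}^1$ topology. Let $f:\mathbb{A}\to\mathbb{A}$ be a $\mathcal{C}^1$ diffeomorphism isotopic to the identity, and $(f_t)_{t\in[0,1]}$ an isotopy with $f_0=\mathrm{Id}$, $f_1=f$. For $x\in\mathbb{A}$ and $\xi\in T_x\mathbb{A}\setminus\{0\}$ let $\tilde v(x,\xi):[0,1]\to\mathbb{R}$ be a continuous lift of $t\mapsto\theta(\chi,Df_t(x)\xi)\in\mathbb{T}$,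 and put $\mathrm{Torsion}_1(f,x,\xi)=\tilde v(x,\xi)(1)-\tilde v(x,\xi)(0)$. This does not depend on the lift nor on the chosen isotopy. A negative-torsion map is a $\mathcal{C}^1$ diffeomorphism $f:\mathbb{A}\to\mathbb{A}$ isotopic to the identity such that $\mathrm{Torsion}_1(f,z,\chi)<0$ for every $z\in\mathbb{A}$. An essential curve is a $\mathcal{C}^0$ embedded circle $\gamma:\mathbb{T}\to\mathbb{A}$ not homotopic to a point; it is a $\mathcal{C}^1$ essential curve if $\gamma$ is moreover a $\mathcal{C}^1$ embedding (so $\gamma'(s)\neq0$ for all $s$). It is $f$-invariant if $f(\gamma(\mathbb{T}))=\gamma(\mathbb{T})$. The restriction $f_{|\gamma}$ of $f$ to $\gamma(\mathbb{T})$ is non-wandering if for every non-empty (relatively) open set $U\subset\gamma(\mathbb{T})$ there is an integer $N\ge1$ with $f^N(U)\cap U\neq\emptyset$. *)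

(* Defs.v *)
From HB Require Import structures.
From mathcomp Require Import all_boot all_order all_algebra.
From mathcomp Require Import all_classical all_reals all_analysis.

Set Implicit Arguments.
Unset Strict Implicit.
Unset Printing Implicit Defensive.

Import Order.TTheory GRing.Theory Num.Theory.
Import numFieldNormedType.Exports.

Local Open Scope classical_set_scope.
Local Open Scope ring_scope.
Local Open Scope quotient_scope.

Definition eq_mod1 (R : realType) : rel R := fun x y => x - y \is a Num.int.

Lemma eq_mod1_refl (R : realType) : reflexive (@eq_mod1 R).
Proof. by move=> x; rewrite /eq_mod1 subrr rpred0. Qed.

Lemma eq_mod1_sym (R : realType) : symmetric (@eq_mod1 R).
Proof. by move=> x y; rewrite /eq_mod1 -opprB rpredN. Qed.

Lemma eq_mod1_trans (R : realType) : transitive (@eq_mod1 R).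
Proof.
move=> y x z xy yz; rewrite /eq_mod1.
by rewrite -[x](subrK y) -addrA rpredD.
Qed.

Definition equiv_mod1 (R : realType) : equiv_rel R :=
  EquivRel (@eq_mod1 R) (@eq_mod1_refl R) (@eq_mod1_sym R) (@eq_mod1_trans R).

Definition circle (R : realType) : topologicalType :=
  quotient_topology {eq_quot (equiv_mod1 R)}.

Definition to_circle (R : realType) (x : R) : circle R :=
  \pi_(quotient_topology {eq_quot (equiv_mod1 R)}) x.

Definition annulus (R : realType) : topologicalType := (circle R * R)%type.

Definition to_annulus (R : realType) (p : R * R) : annulus R :=
  (to_circle p.1, p.2).

(* Differential calculus between quotients [pX : E -> X], [pY : E' -> Y] of
   normed spaces by discrete groups of translations (here R -> circle,
   R * R -> annulus, or the identity of R), whose tangent bundles are trivialized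
   by E and E': [D] is the tangent map of [f] when, near each p in E, f lifts
   to some F : E -> E' whose differential at p is [D (pX p)]. *)
Definition tangent_map (R : realType) (E E' : normedModType R)
    (X Y : topologicalType) (pX : E -> X) (pY : E' -> Y)
    (f : X -> Y) (D : X -> E -> E') : Prop :=
  forall p : E, exists F : E -> E',
    (\forall q \near p, pY (F q) = f (pX q)) /\ is_diff p F (D (pX p)).

(* E is always finite dimensional here, so continuity of the operator-valued
   map [D] is continuity of [D ^~ v] for each fixed v. *)
Definition C1_tangent_map (R : realType) (E E' : normedModType R)
    (X Y : topologicalType) (pX : E -> X) (pY : E' -> Y)
    (f : X -> Y) (D : X -> E -> E') : Prop :=
  tangent_map pX pY f D /\ forall v : E, continuous (fun x => D x v).

Definition C1_annulus (R : realType) (f : annulus R -> annulus R) : Prop :=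
  exists D, C1_tangent_map (@to_annulus R) (@to_annulus R) f D.

Definition C1_diffeo (R : realType) (f : annulus R -> annulus R) : Prop :=
  exists g : annulus R -> annulus R,
    [/\ cancel f g, cancel g f, C1_annulus f & C1_annulus g].

(* A path t |-> ft t, t in [0, 1], in Diff^1(A), with tangent maps Dt t, that is
   continuous for the weak C^1 topology: ft and Dt vary continuously for the
   topology of uniform convergence on compact sets. *)
Definition isotopy (R : realType) (ft : R -> annulus R -> annulus R)
    (Dt : R -> annulus R -> R * R -> R * R) : Prop :=
  [/\ forall t : R, t \in `[0, 1] -> C1_diffeo (ft t) /\
        C1_tangent_map (@to_annulus R) (@to_annulus R) (ft t) (Dt t),
      {within `[0, 1], continuous
        (ft : R -> {compact-open, annulus R -> annulus R})} &
      forall v : R * R, {within `[0, 1], continuous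
        ((fun t z => Dt t z v) :
           R -> {compact-open, annulus R -> (R * R)%type})}].

Definition chi (R : realType) : R * R := (0, 1).

Definition rotation (R : realType) (a : R) (u : R * R) : R * R :=
  (cos a * u.1 - sin a * u.2, sin a * u.1 + cos a * u.2).

(* The set below is, for nonzero u and v, a single class modulo 1. *)
Definition oriented_angle (R : realType) (u v : R * R) : circle R :=
  to_circle (xget 0 [set a : R |
    exists2 r : R, 0 < r & v = r *: rotation (2 * pi * a) u]).

(* tau is the value Torsion_1(f, z, xi) computed along an isotopy from the
   identity to f whose tangent maps are Dt. *)
Definition is_torsion1 (R : realType) (Dt : R -> annulus R -> R * R -> R * R)
    (z : annulus R) (xi : R * R) (tau : R) : Prop :=
  exists w : R -> R,
    [/\ {within `[0, 1], continuous w},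
        forall t : R, t \in `[0, 1] ->
          to_circle (w t) = oriented_angle (chi R) (Dt t z xi) &
        tau = w 1 - w 0].

(* Since Torsion_1(f, z, xi) depends on neither the isotopy from the identity
   to f nor the lift, it may be computed with any choice of them. *)
Definition negative_torsion_map (R : realType)
    (f : annulus R -> annulus R) : Prop :=
  C1_diffeo f /\
  exists ft Dt, [/\ isotopy ft Dt, ft 0 = id, ft 1 = f &
    forall z : annulus R, exists2 tau : R,
      is_torsion1 Dt z (chi R) tau & tau < 0].

Definition homotopic_to_point (R : realType)
    (gamma : circle R -> annulus R) : Prop :=
  exists (H : R * circle R -> annulus R) (c : annulus R),
    [/\ {within `[0, 1] `*` setT, continuous H},
        forall s, H (0, s) = gamma s & forall s, H (1, s) = c].

(* The circle is compact and the annulus Hausdorff, so an injective continuous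
   map is a topological embedding. *)
Definition essential_curve (R : realType)
    (gamma : circle R -> annulus R) : Prop :=
  [/\ continuous gamma, injective gamma & ~ homotopic_to_point gamma].

Definition C1_essential_curve (R : realType)
    (gamma : circle R -> annulus R) : Prop :=
  essential_curve gamma /\
  exists2 D : circle R -> R -> R * R,
    C1_tangent_map (@to_circle R) (@to_annulus R) gamma D &
    forall s, D s 1 != 0.

Definition invariant_curve (R : realType) (f : annulus R -> annulus R)
    (gamma : circle R -> annulus R) : Prop :=
  f @` range gamma = range gamma.

Definition nonwandering_on (R : realType) (f : annulus R -> annulus R)
    (C : set (annulus R)) : Prop :=
  forall V : set (annulus R), open V -> C `&` V !=set0 ->
    exists2 N : nat, (1 <= N)%N &
      (iter N f @` (C `&` V)) `&` (C `&` V) !=set0.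

Definition C1_circle_function (R : realType) (psi : circle R -> R) : Prop :=
  exists D, C1_tangent_map (@to_circle R) (@id R) psi D.

(* Main.v *)
(* Lift the curve to [c : R -> R^2] with [c (s + 1) = c s + (d, 0)]; [d <> 0]
   because the curve is essential. Lift the isotopy to [F] starting at the identity.
   For [0 <= u <= 1] the secant from [F_t (c s)] to [F_t (c (s + u))], replaced by the
   tangent vector when [u = 0], never vanishes, so it has an angle [A (t, s, u)]
   continuous in all three variables, and [A (t, s, 1)] is constant since that secant
   is [(d, 0)]. Comparing the secants of [f o c] and of [c o ph], where [ph] lifts the
   dynamics on the curve, from [u = 1] down to [u = 0] shows that the tangent angle
   [a s = A (0, s, 0)] is 1-periodic and that the isotopy carries [a s] to exactly
   [a (ph s)], with no additional integer (this replaces an Umlaufsatz).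
   Negative torsion then sends [{a <= n/2}] into [{a < n/2}] for every integer [n]. If
   such a set were neither empty nor everything, the dynamics would have wandering
   points; hence [a] avoids every [n/2], the curve is nowhere vertical, its
   first coordinate is invertible, and injectivity forces [d = 1] or [d = -1]. *)
Require Import Defs.
From mathcomp Require Import all_boot all_order all_algebra.
From mathcomp Require Import all_classical all_reals all_analysis.
From mathcomp Require Import ring lra zify.

Set Implicit Arguments.
Unset Strict Implicit.
Unset Printing Implicit Defensive.

Import Order.TTheory GRing.Theory Num.Theory.
Import numFieldNormedType.Exports.

Local Open Scope classical_set_scope.
Local Open Scope ring_scope.

(** * Angles of plane vectors *)

(** Angles are in turns counted from the vertical [chi], matching [oriented_angle]; a vector is
    vertical exactly when its angle is a half-integer. *)
Definition dir (R : realType) (a : R) : R * R := rotation (2 * pi * a) (chi R).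

Lemma dirE (R : realType) (a : R) :
  dir a = (- sin (2 * pi * a), cos (2 * pi * a)).
Proof. by rewrite /dir /rotation /chi /= !mulr0 !mulr1 !add0r. Qed.

Lemma dir_norm (R : realType) (a : R) : (dir a).1 ^+ 2 + (dir a).2 ^+ 2 = 1.
Proof. by rewrite dirE/= sqrrN addrC cos2Dsin2. Qed.

Lemma int_lt1_eq0 (R : realType) (x : R) : x \is a Num.int -> `|x| < 1 -> x = 0.
Proof.
move=> /intrP[m ->]; rewrite -intr_norm -[1]/(1%:~R) ltr_int => h.
have -> // : m = 0 by lia.
Qed.

Lemma dirDn (R : realType) (a : R) (n : nat) : dir (a + n%:R) = dir a.
Proof.
rewrite !dirE mulrDr.
have -> : 2 * pi * n%:R = pi *+ 2 *+ n :> R.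
  by rewrite -(mulr_natl (pi *+ 2)) -(mulr_natl pi) [RHS]mulrC.
by rewrite (periodicn (@sinD2pi R)) (periodicn (@cosD2pi R)).
Qed.

Lemma dirDint (R : realType) (a k : R) : k \is a Num.int -> dir (a + k) = dir a.
Proof.
move=> /intrP[[n|n] ->]; first exact: dirDn.
by rewrite NegzE mulrNz -[in RHS](subrK n.+1%:~R a) dirDn.
Qed.

Lemma dirDhalf (R : realType) (a : R) : dir (a + 2^-1) = - dir a.
Proof.
rewrite !dirE mulrDr.
have -> : 2 * pi * 2^-1 = pi :> R by lra.
by rewrite sinDpi cosDpi; congr pair.
Qed.

Lemma cos_eq1_int (R : realType) (x : R) : cos (2 * pi * x) = 1 -> x \is a Num.int.
Proof.
move=> cx1; pose y : R := x - (Num.floor x)%:~R.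
have cy : cos (2 * pi * y) = 1.
  have := congr1 snd (@dirDint R y (Num.floor x)%:~R (intr_int _ _)).
  by rewrite !dirE/= subrK cx1.
have y0 : 0 <= y by rewrite subr_ge0 ge_floor.
have y1 : y < 1 by rewrite ltrBlDr addrC -[1]/(1%:~R) -intrD; exact: floorD1_gt.
have pi0 := pi_gt0 R.
suff y00 : y = 0 by rewrite (_ : x = (Num.floor x)%:~R) ?intr_int//; apply/subr0_eq.
have [yh|yh] := leP y (2^-1).
  suff : 2 * pi * y = 0.
    by move/eqP; rewrite !mulf_eq0 (gt_eqF pi0) (_ : 2 == 0 = false) ?pnatr_eq0//= => /eqP.
  by apply: cos_inj; rewrite ?in_itv/= ?lexx ?pi_ge0 ?cy ?cos0//; nra.
(* Beyond half a turn, evenness and periodicity of [cos] replace [y] by [1 - y], which lies where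
   [cos] is injective; the result contradicts [y < 1]. *)
suff : 2 * pi * (1 - y) = 0 by nra.
apply: cos_inj; rewrite ?in_itv/= ?lexx ?pi_ge0 ?cos0//; first by nra.
rewrite -[RHS]cy -[RHS]cosN -[RHS]cosD2pi; congr cos.
by rewrite -(mulr_natl pi); ring.
Qed.

(** Unit norms force [c = 1]; equal sines and cosines then give the difference of the angles cosine
    1. *)
Lemma dir_scale_int (R : realType) (a b c : R) :
  0 < c -> dir a = c *: dir b -> a - b \is a Num.int.
Proof.
move=> c0 ab; have := dir_norm a; rewrite ab/=.
rewrite /GRing.scale/= /GRing.scale/= !exprMn -mulrDr dir_norm mulr1 => c1.
have {c1 c0} c1 : c = 1 by nra.
move: ab; rewrite c1 scale1r !dirE => -[/oppr_inj es ec].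
by apply: cos_eq1_int; rewrite mulrBr cosB es ec -!expr2 cos2Dsin2.
Qed.

(** A negative factor is absorbed by a half turn, hence the factor 2 in the conclusion; [c = 0] is
    excluded by the unit norm of [dir a]. *)
Lemma dir_collinear (R : realType) (a b c : R) :
  dir a = c *: dir b -> 2 * (a - b) \is a Num.int.
Proof.
have [c0|c0|<-] := ltgtP 0 c.
- by move=> /(dir_scale_int c0) ab; rewrite rpredM// -[2]/(2%:~R) intr_int.
- move=> ab; have : dir (a + 2^-1) = (- c) *: dir b by rewrite dirDhalf ab scaleNr.
  rewrite -oppr_gt0 in c0 => /(dir_scale_int c0) h.
  have -> : 2 * (a - b) = 2 * (a + 2^-1 - b) - 1 by lra.
  by rewrite rpredB ?rpredM ?rpred1// -[2]/(2%:~R) intr_int.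
- by rewrite scale0r => h; have := dir_norm a; rewrite h/= expr0n addr0 => /esym/eqP;
    rewrite oner_eq0.
Qed.

(** Whole turns leave [dir] unchanged, so only the parity of the number of half turns matters. *)
Lemma dir_half_int (R : realType) (a b : R) :
  2 * (a - b) \is a Num.int -> dir a = dir b \/ dir a = - dir b.
Proof.
move=> /intrP[m hm].
have -> : a = b + m%:~R / 2 by rewrite -hm; lra.
have [q [e ->]] : exists q : int, exists e : bool, m = 2 * q + (e : nat)%:Z.
  exists (m %/ 2)%Z, ((m %% 2)%Z == 1).
  by have := divz_eq m 2; have := @modz_ge0 m 2; have := @ltz_pmod m 2; lia.
have -> : b + (2 * q + (e : nat)%:Z)%:~R / 2 = (b + e%:R / 2) + q%:~R.
  by rewrite rmorphD rmorphM/=; lra.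
rewrite dirDint ?intr_int//; case: e; last by left; rewrite mul0r addr0.
by right; rewrite mul1r dirDhalf.
Qed.

Definition dot (R : realType) (u v : R * R) : R := u.1 * v.1 + u.2 * v.2.
Definition cross (R : realType) (u v : R * R) : R := u.1 * v.2 - u.2 * v.1.
(** The signed angle from [u] to [v], meaningful when [dot u v > 0]: it is then less than a quarter
    turn and depends continuously on both vectors. *)
Definition turn (R : realType) (u v : R * R) : R :=
  atan (cross u v / dot u v) / (2 * pi).

Lemma turnP (R : realType) (u v : R * R) (a r : R) : 0 < r -> 0 < dot u v ->
  u = r *: dir a -> exists2 r', 0 < r' & v = r' *: dir (a + turn u v).
Proof.
move=> r0 d0 ua; rewrite dirE mulrDr.
have pi0 := pi_gt0 R.
have -> : 2 * pi * turn u v = atan (cross u v / dot u v) by rewrite /turn; field; lra.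
set t := cross u v / dot u v.
have c0 : 0 < cos (atan t) by rewrite cos_gt0_pihalf// atan_gtNpi2 atan_ltpi2.
have st : sin (atan t) = t * cos (atan t).
  have : tan (atan t) * cos (atan t) = sin (atan t) by rewrite /tan divfK// gt_eqF.
  by rewrite atanK.
(* This factor is the length of [v]: [dot u v] is [r] times that length times the cosine of the
   angle between the vectors. *)
exists (dot u v / (r * cos (atan t))); first by rewrite divr_gt0 ?mulr_gt0.
have scv : sin (2 * pi * a) ^+ 2 + cos (2 * pi * a) ^+ 2 = 1 by rewrite addrC cos2Dsin2.
rewrite sinD cosD st.
have ct : cross u v = t * dot u v by rewrite /t divfK// gt_eqF.
clearbody t; move: ct d0; rewrite /cross /dot ua dirE/= /GRing.scale/=.
rewrite /GRing.scale/=.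
set S := sin (2 * pi * a) in scv *; set C := cos (2 * pi * a) in scv *.
set c := cos (atan t) in c0 *.
move=> ct d0; case: v ct d0 => v1 v2/= ct d0.
have rc : r * c != 0 by rewrite gt_eqF ?mulr_gt0.
(* Inserting [S ^+ 2 + C ^+ 2 = 1] turns both coordinate equations into polynomial identities. *)
have E1 : (S ^+ 2 + C ^+ 2) * v1 = v1 by rewrite scv mul1r.
have E2 : (S ^+ 2 + C ^+ 2) * v2 = v2 by rewrite scv mul1r.
congr pair; apply: (mulIf rc); rewrite [RHS]mulrAC divfK//=.
  transitivity (- S * c * (r * - S * v1 + r * C * v2) - C * c * (t * (r * - S * v1 + r *
      C * v2))).
    by rewrite -ct -[in LHS]E1; ring.
  by ring.
transitivity (C * c * (r * - S * v1 + r * C * v2) - S * c * (t * (r * - S * v1 + r * C *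
    v2))).
  by rewrite -ct -[in LHS]E2; ring.
by ring.
Qed.

(** One of the four axis directions has positive scalar product with [v], and [turn] corrects its
    angle. *)
Lemma dir_exists (R : realType) (v : R * R) : v != 0 ->
  exists a r : R, 0 < r /\ v = r *: dir a.
Proof.
move=> v0.
suff [b hb] : exists b, 0 < dot (dir b) v.
  have [||r' r0 ->] := @turnP R (dir b) v b 1 _ hb; rewrite ?scale1r//.
  by exists (b + turn (dir b) v), r'.
have d0 : dir (0 : R) = (0, 1) by rewrite dirE mulr0 sin0 cos0 oppr0.
have d1 : dir (4^-1 : R) = (- 1, 0).
  by rewrite dirE (_ : 2 * pi / 4 = pi / 2) ?sin_pihalf ?cos_pihalf//; lra.
have [h|h|h0] := ltgtP 0 v.2.
- by exists 0; rewrite d0 /dot/= mul0r mul1r add0r.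
- by exists (0 + 2^-1); rewrite dirDhalf d0 /dot/= oppr0 mul0r add0r mulN1r oppr_gt0.
have [h|h|h1] := ltgtP 0 v.1.
- by exists (4^-1 + 2^-1); rewrite dirDhalf d1 /dot/= oppr0 mul0r opprK addr0 mul1r.
- by exists 4^-1; rewrite d1 /dot/= mul0r addr0 mulN1r oppr_gt0.
- by case: v v0 h0 h1 => x y /= /eqP xy y0 x0; case: xy; rewrite -x0 -y0.
Qed.

(** * Continuous determination of the angle *)

Lemma continuous_pair (T U W : topologicalType) (f : T -> U) (g : T -> W) :
  continuous f -> continuous g -> continuous (fun x => (f x, g x)).
Proof. by move=> cf cg x; apply: cvg_pair; [exact: cf|exact: cg]. Qed.

Lemma continuous_compose (T U W : topologicalType) (f : T -> U) (g : U -> W) :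
  continuous f -> continuous g -> continuous (fun x => g (f x)).
Proof. by move=> cf cg x; apply: continuous_comp; [exact: cf|exact: cg]. Qed.

Lemma continuous_fst (T U : topologicalType) : continuous (@fst T U).
Proof. by move=> x; exact: cvg_fst. Qed.

Lemma continuous_snd (T U : topologicalType) : continuous (@snd T U).
Proof. by move=> x; exact: cvg_snd. Qed.

Lemma continuous_add (T : topologicalType) (K : numFieldType) (V : normedModType K)
    (f g : T -> V) :
  continuous f -> continuous g -> continuous (fun x => f x + g x).
Proof. by move=> cf cg x; apply: continuousD; [exact: cf|exact: cg]. Qed.

Lemma continuous_sub (T : topologicalType) (K : numFieldType) (V : normedModType K)
    (f g : T -> V) :
  continuous f -> continuous g -> continuous (fun x => f x - g x).
Proof. by move=> cf cg x; apply: continuousB; [exact: cf|exact: cg]. Qed.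

Lemma continuous_mul (T : topologicalType) (K : numFieldType) (f g : T -> K) :
  continuous f -> continuous g -> continuous (fun x => f x * g x).
Proof. by move=> cf cg x; apply: continuousM; [exact: cf|exact: cg]. Qed.

Lemma continuous_scale (T : topologicalType) (K : numFieldType) (V : normedModType K)
    (f : T -> K) (g : T -> V) :
  continuous f -> continuous g -> continuous (fun x => f x *: g x).
Proof. by move=> cf cg x; apply: continuousZ; [exact: cf|exact: cg]. Qed.

Lemma continuous_id (T : topologicalType) : continuous (fun x : T => x).
Proof. by move=> x. Qed.

Lemma continuous_const (T U : topologicalType) (c : U) : continuous (fun x : T => c).
Proof. by move=> x; exact: cst_continuous. Qed.

(** Retraction of the line onto a segment: it extends maps given on [[0, 1]] to the whole line, so
    that lifting can be done on normed spaces. *)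
Definition clamp (R : realType) (lo hi t : R) : R := Num.max lo (Num.min t hi).

Lemma continuous_clamp (R : realType) (lo hi : R) : continuous (clamp lo hi).
Proof.
apply: (@max_fun_continuous _ _ R (fun=> lo)); first exact: continuous_const.
apply: (@min_fun_continuous _ _ R id (fun=> hi)); first exact: continuous_id.
exact: continuous_const.
Qed.

Lemma clamp_itv (R : realType) (lo hi t : R) : lo <= hi -> lo <= clamp lo hi t <= hi.
Proof. by move=> h; rewrite /clamp le_max lexx ge_max h ge_min lexx orbT. Qed.

Lemma clamp_id (R : realType) (lo hi t : R) : lo <= t <= hi -> clamp lo hi t = t.
Proof. by move=> /andP[h1 h2]; rewrite /clamp min_l// max_r. Qed.

Lemma IVT_value (R : realType) (g : R -> R) (x y v : R) : continuous g ->
  g x <= v <= g y -> exists z, g z = v.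
Proof.
move=> cg /andP[gx gy].
have cw a b : {within `[a, b], continuous g} by apply: continuous_subspaceT.
have [xy|/ltW xy] := leP x y.
  have [|z _ hz] := IVT xy (cw x y) (v := v); last by exists z.
  by rewrite ge_min gx le_max gy orbT.
have [|z _ hz] := IVT xy (cw y x) (v := v); last by exists z.
by rewrite ge_min gx le_max gy orbT.
Qed.

(** An increase would make [g] take the value [g x + 2^-1], which is not an integer. *)
Lemma continuous_int_lt (R : realType) (g : R -> R) : continuous g ->
  (forall x, g x \is a Num.int) -> forall x y, ~ g x < g y.
Proof.
move=> cg ig x y xy.
have gx1 : g x + 1 <= g y.
  have /intrP[m hm] := ig x; have /intrP[n hn] := ig y.
  by move: xy; rewrite hm hn -[1]/(1%:~R) -intrD ltr_int ler_int; lia.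
have [|z hz] := @IVT_value R g x y (g x + 2^-1) cg; first by lra.
have h : g z - g x \is a Num.int by rewrite rpredB.
have : g z - g x = 0 by apply: int_lt1_eq0; rewrite // hz addrC addKr ger0_norm
    ?invr_ge0//; lra.
by rewrite hz; lra.
Qed.

Lemma continuous_int_const (R : realType) (T : normedModType R) (g : T -> R) :
  continuous g -> (forall x, g x \is a Num.int) -> forall x y, g x = g y.
Proof.
move=> cg ig x y; pose h (t : R) := g (x + t *: (y - x)).
have ch : continuous h.
  apply: (@continuous_compose R T R (fun t => x + t *: (y - x)) g) => //.
  apply: continuous_add; first exact: continuous_const.
  by apply: continuous_scale; [exact: continuous_id|exact: continuous_const].
have ih t : h t \is a Num.int by exact: ig.
have -> : g x = h 0 by rewrite /h scale0r addr0.
have -> : g y = h 1 by rewrite /h scale1r addrC subrK.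
by apply/eqP; rewrite eq_le !leNgt; apply/andP; split; apply/negP; exact: continuous_int_lt.
Qed.

Lemma dot_self_gt0 (R : realType) (v : R * R) : v != 0 -> 0 < dot v v.
Proof.
case: v => x y xy; rewrite /dot/= lt_neqAle -!expr2 addr_ge0 ?sqr_ge0// andbT.
rewrite eq_sym paddr_eq0 ?sqr_ge0// !expf_eq0/=.
by apply: contra xy => /andP[/eqP -> /eqP ->]; apply/eqP.
Qed.

(** The pairs in [K] with [dot <= 0] form a compact set missing the diagonal, so the distance
    between their two members has a positive minimum. *)
Lemma dot_gt0_near_diag (R : realType) (T : normedModType R) (V : T -> R * R) (K : set T) :
  compact K -> continuous V -> (forall p, V p != 0) ->
  exists2 d : R, 0 < d & forall p q, K p -> K q -> `|p - q| < d -> 0 < dot (V p) (V q).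
Proof.
move=> cK cV V0.
pose F (z : T * T) := dot (V z.1) (V z.2).
have cF : continuous F.
  have cV1 : continuous (fun z : T * T => V z.1) := continuous_compose (@continuous_fst _
      _) cV.
  have cV2 : continuous (fun z : T * T => V z.2) := continuous_compose (@continuous_snd _
      _) cV.
  by apply: continuous_add; apply: continuous_mul;
    apply: (@continuous_compose _ (R * R)%type); by [exact: cV1|exact: cV2|exact:
        continuous_fst|exact: continuous_snd].
pose D := (K `*` K) `&` [set z | F z <= 0].
have cD : compact D.
  apply: compact_closedI; first exact: compact_setX.
  by apply: (@closed_comp _ _ F [set x | x <= 0]); [move=> z _; exact: cF|exact: closed_le].
have [D0|/set0P Dn] := eqVneq D set0.
  exists 1 => // p q Kp Kq _; rewrite ltNge; apply/negP => h.
  by have : D (p, q) by []; rewrite D0.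
have [|c] := @compact_EVT_min _ R (fun z : T * T => `|z.1 - z.2|) D Dn cD.
  apply: continuous_subspaceT; apply: (@continuous_compose _ T R (fun z : T * T => z.1 -
      z.2) Num.norm).
    by apply: continuous_sub; [exact: continuous_fst|exact: continuous_snd].
  exact: norm_continuous.
rewrite inE => -[[Kc1 Kc2] Fc] hc.
exists `|c.1 - c.2|.
  rewrite normr_gt0 subr_eq0; apply/eqP => c12.
  have : 0 < F c by rewrite /F c12 dot_self_gt0.
  by rewrite ltNge => /negP; apply.
move=> p q Kp Kq; rewrite !ltNge; apply: contra => h.
by apply: (hc (p, q)); rewrite inE.
Qed.

(* On a ball, the angle of [V p] is the angle of [V 0] plus the small turns
   of [V] along a fine subdivision of the segment from [0] to [p]. *)
Lemma angle_lift_ball (R : realType) (T : normedModType R) (V : T -> R * R) (M a0 r0 : R) :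
  compact [set p : T | `|p| <= M] -> continuous V -> (forall p, V p != 0) ->
  0 < r0 -> V 0 = r0 *: dir a0 ->
  exists A : T -> R, [/\ forall p, `|p| <= M -> {for p, continuous A},
    forall p, `|p| <= M -> exists2 r, 0 < r & V p = r *: dir (A p) & A 0 = a0].
Proof.
move=> cK cV V0 r00 V0a.
have [d d0 hd] := dot_gt0_near_diag cK cV V0.
(* With [N] subdivisions, consecutive points of the segment to [p] are less than [d] apart, so each
   turn is well defined. *)
pose N := (Num.truncn (`|M| / d)).+1.
have N0 : (0 : R) < N%:R by rewrite ltr0n.
have MN : M < N%:R * d.
  rewrite -ltr_pdivrMr//; apply: le_lt_trans (truncnS_gt _).
  by rewrite ler_pM2r ?invr_gt0// ler_norm.
pose pt (i : nat) (p : T) := (i%:R / N%:R) *: p.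
have ptK i p : (i <= N)%N -> `|p| <= M -> `|pt i p| <= M.
  move=> iN pM; rewrite normrZ ger0_norm ?divr_ge0//.
  by rewrite (le_trans _ pM)// ler_piMl// ler_pdivrMr// mul1r ler_nat.
have dpos i p : (i < N)%N -> `|p| <= M -> 0 < dot (V (pt i p)) (V (pt i.+1 p)).
  move=> iN pM; apply: hd; [exact: ptK (ltnW iN) pM|exact: ptK iN pM|].
  rewrite distrC /pt -scalerBl -mulrBl -natrB// subSnn normrZ ger0_norm ?divr_ge0//.
  by rewrite mul1r mulrC ltr_pdivrMr// mulrC (le_lt_trans pM).
have cpt i : continuous (fun p => V (pt i p)).
  apply: (@continuous_compose _ T _ (pt i) V) => //.
  by apply: continuous_scale; [exact: continuous_const|exact: continuous_id].
pose S k p := a0 + \sum_(i < k) turn (V (pt i p)) (V (pt i.+1 p)).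
exists (S N); split.
- move=> p pM; rewrite /S.
  have cS k : (k <= N)%N -> {for p, continuous (S k)}.
    elim: k => [_|k ih kN].
      rewrite (_ : S 0%N = fun=> a0); first exact: cst_continuous.
      by apply/funext => q; rewrite /S big_ord0 addr0.
    rewrite (_ : S k.+1 = fun q => S k q + turn (V (pt k q)) (V (pt k.+1 q))); last first.
      by apply/funext => q; rewrite /S big_ord_recr/= addrA.
    apply: continuousD; first exact/ih/ltnW.
    rewrite /turn; apply: continuousM; last exact: cst_continuous.
    apply: (@continuous_comp _ R R (fun q => cross (V (pt k q)) (V (pt k.+1 q)) / dot (V
        (pt k q)) (V (pt k.+1 q))) (@atan R)); last exact: continuous_atan.
    have cf i := continuous_compose (cpt i) (@continuous_fst _ _).
    have cs i := continuous_compose (cpt i) (@continuous_snd _ _).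
    apply: continuousM.
      exact: (continuous_sub (continuous_mul (cf k) (cs k.+1)) (continuous_mul (cs k) (cf
          k.+1))).
    apply: continuousV; first by rewrite gt_eqF//; exact: dpos.
    exact: (continuous_add (continuous_mul (cf k) (cf k.+1)) (continuous_mul (cs k) (cs
        k.+1))).
  exact: cS.
- move=> p pM.
  have hS k : (k <= N)%N -> exists2 r, 0 < r & V (pt k p) = r *: dir (S k p).
    elim: k => [_|k ih kN].
      by exists r0; rewrite // /pt mul0r scale0r /S big_ord0 addr0.
    have [r r1 hr] := ih (ltnW kN).
    have [r' r'0 hr'] := turnP r1 (dpos k p kN pM) hr.
    by exists r'; rewrite // hr' /S big_ord_recr/= addrA.
  by have := hS N (leqnn _); rewrite /pt divff ?gt_eqF// scale1r.
- rewrite /S big1 ?addr0// => i _; rewrite /pt !scaler0 /turn /cross.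
  by rewrite [X in X - _]mulrC subrr mul0r atan0 mul0r.
Qed.

(** The determinations on balls glue: along the segment from 0 to a common point, two of them differ
    by a continuous integer that vanishes at 0. *)
Lemma angle_lift (R : realType) (T : normedModType R) (V : T -> R * R) :
  (forall M : R, compact [set p : T | `|p| <= M]) ->
  continuous V -> (forall p, V p != 0) ->
  exists2 A : T -> R, continuous A & forall p, exists2 r, 0 < r & V p = r *: dir (A p).
Proof.
move=> cK cV V0.
have [a0 [r0 [r00 hr0]]] := dir_exists (V0 0).
have /choice[A hA] := fun M : R => angle_lift_ball (cK M) cV V0 r00 hr0.
have AA (M M' : R) p : `|p| <= M -> `|p| <= M' -> A M p = A M' p.
  move=> pM pM'.
  have clb t : 0 <= clamp 0 1 t <= 1 := clamp_itv t (@ler01 R).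
  have sM t : `|clamp 0 1 t *: p| <= `|p|.
    by have /andP[h0 h1] := clb t; rewrite normrZ ger0_norm// ler_piMl.
  have ccl : continuous (fun t => clamp 0 1 t *: p).
    apply: continuous_scale; last exact: continuous_const.
    exact: continuous_clamp.
  pose g t := A M (clamp 0 1 t *: p) - A M' (clamp 0 1 t *: p).
  have cg : continuous g.
    have [cM _ _] := hA M; have [cM' _ _] := hA M'.
    by move=> t; apply: continuousB;
      [apply: (@continuous_comp _ _ _ (fun t => clamp 0 1 t *: p) (A M)) | apply:
          (@continuous_comp _ _ _ (fun t => clamp 0 1 t *: p) (A M'))];
      by [exact: ccl|apply: cM; exact: le_trans pM|apply: cM'; exact: le_trans pM'].
  have ig t : g t \is a Num.int.
    have [_ hM _] := hA M; have [_ hM' _] := hA M'.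
    have [r r1 hr] := hM _ (le_trans (sM t) pM).
    have [r' r'1 hr'] := hM' _ (le_trans (sM t) pM').
    apply: (@dir_scale_int _ _ _ (r' / r)); first by rewrite divr_gt0.
    by rewrite mulrC -scalerA -hr' hr scalerA mulVf ?scale1r// gt_eqF.
  have := continuous_int_const cg ig 1 0.
  have [_ _ hM] := hA M; have [_ _ hM'] := hA M'.
  rewrite /g !clamp_id ?lexx ?ler01//.
  by rewrite scale0r scale1r hM hM' subrr => /subr0_eq.
(* The ball used at [p] only reaches [p]; continuity there comes from the ball of radius [|p| + 1],
   which contains a neighbourhood. *)
exists (fun p => A `|p| p); last by move=> p; have [_ + _] := hA `|p|; exact.
move=> p; have [cM _ _] := hA (`|p| + 1).
have hp : `|p| <= `|p| + 1 by rewrite lerDl.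
have := cM p hp; rewrite /prop_for /continuous_at -(AA `|p|)//.
apply: cvg_trans; apply: near_eq_cvg.
near=> q; rewrite (AA _ (`|p| + 1))//.
rewrite ltW// -ltrBlDl; apply: le_lt_trans (lerB_dist _ _) _.
by rewrite distrC; near: q; apply: cvgr_dist_lt => //; exact: cvg_id.
Unshelve. all: by end_near. Qed.

(** * Lifts to the universal covers *)

Lemma compact_ballR (R : realType) (M : R) : compact [set p : R | `|p| <= M].
Proof.
rewrite (_ : [set _ | _] = `[(- M), M]%classic); first exact: segment_compact.
by apply/seteqP; split => x; rewrite /= in_itv/= ler_norml.
Qed.

Lemma compact_ball_prod (R : realType) (T U : normedModType R) :
  (forall M : R, compact [set p : T | `|p| <= M]) ->
  (forall M : R, compact [set p : U | `|p| <= M]) ->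
  forall M : R, compact [set p : T * U | `|p| <= M].
Proof.
move=> cT cU M; rewrite (_ : [set _ | _] = [set p | `|p| <= M] `*` [set p | `|p| <= M]).
  exact: compact_setX.
by apply/seteqP; split => [[x y]|[x y]]; rewrite /= prod_normE/= ge_max => /andP.
Qed.

Lemma compact_ballR2 (R : realType) (M : R) : compact [set p : R * R | `|p| <= M].
Proof. exact: compact_ball_prod (@compact_ballR R) (@compact_ballR R) M. Qed.

Lemma compact_ballR3 (R : realType) (M : R) : compact [set p : R * (R * R) | `|p| <= M].
Proof. exact: compact_ball_prod (@compact_ballR R) (@compact_ballR2 R) M. Qed.

Lemma to_circleP (R : realType) (x y : R) :
  to_circle x = to_circle y <-> x - y \is a Num.int.
Proof. by split => [/eqmodP//|h]; apply/eqmodP. Qed.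

Lemma to_circle_repr (R : realType) (c : circle R) : to_circle (repr c) = c.
Proof. exact: reprK. Qed.

Lemma continuous_to_circle (R : realType) : continuous (@to_circle R).
Proof. exact: pi_continuous. Qed.

Lemma continuous_circle (R : realType) (Z : topologicalType) (f : circle R -> Z) :
  continuous (fun x => f (to_circle x)) -> continuous f.
Proof. by move=> h; apply/quotient_continuous. Qed.

Lemma to_circleDint (R : realType) (x k : R) :
  k \is a Num.int -> to_circle (x + k) = to_circle x.
Proof. by move=> h; apply/to_circleP; rewrite addrAC subrr add0r. Qed.

Lemma dir_repr (R : realType) (x : R) : dir (repr (to_circle x)) = dir x.
Proof.
rewrite -[repr _](subrK x) addrC dirDint//.
by apply/to_circleP; rewrite to_circle_repr.
Qed.

Lemma continuous_dir (R : realType) : continuous (@dir R).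
Proof.
rewrite (_ : @dir R = fun a => (- sin (2 * pi * a), cos (2 * pi * a))); last
    exact/funext/dirE.
have c2 : continuous (fun a : R => 2 * pi * a).
  by apply: continuous_mul; [exact: continuous_const|exact: continuous_id].
apply: continuous_pair; last by apply: (continuous_compose c2); exact: continuous_cos.
move=> x; apply: continuousN; move: x.
by apply: (continuous_compose c2); exact: continuous_sin.
Qed.

Definition circle_dir (R : realType) (c : circle R) : R * R := dir (repr c).

Lemma continuous_circle_dir (R : realType) : continuous (@circle_dir R).
Proof.
apply: continuous_circle; rewrite (_ : (fun _ => _) = @dir R); first exact: continuous_dir.
by apply/funext => x; exact: dir_repr.
Qed.

Lemma circle_dir_inj (R : realType) : injective (@circle_dir R).
Proof.
move=> c d h; rewrite -(to_circle_repr c) -(to_circle_repr d); apply/to_circleP.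
by apply: (@dir_scale_int _ _ _ 1); rewrite // scale1r.
Qed.

(** The map [circle_dir] embeds the circle in the plane as unit vectors, so lifting to the line is
    choosing a continuous angle. *)
Lemma circle_lift (R : realType) (T : normedModType R) (h : T -> circle R) :
  (forall M : R, compact [set p : T | `|p| <= M]) -> continuous h ->
  exists2 A : T -> R, continuous A & forall p, to_circle (A p) = h p.
Proof.
move=> cT ch.
have [||A cA hA] := @angle_lift _ _ (fun p => circle_dir (h p)) cT.
- exact: (continuous_compose ch (@continuous_circle_dir R)).
- move=> p; apply/eqP => h0; have := dir_norm (repr (h p)).
  by rewrite -/(circle_dir _) h0/= expr0n addr0 => /esym/eqP; rewrite oner_eq0.
exists A => // p; have [r r0 hr] := hA p.
rewrite -[RHS]to_circle_repr; apply/to_circleP.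
apply: (@dir_scale_int _ _ _ r^-1); first by rewrite invr_gt0.
by rewrite [X in r^-1 *: X]hr scalerA mulVf ?scale1r// gt_eqF.
Qed.

Lemma continuous_to_annulus (R : realType) : continuous (@to_annulus R).
Proof.
apply: continuous_pair; last exact: continuous_snd.
exact: (continuous_compose (@continuous_fst _ _) (@continuous_to_circle R)).
Qed.

Lemma to_annulusP (R : realType) (p q : R * R) :
  to_annulus p = to_annulus q <-> p.1 - q.1 \is a Num.int /\ p.2 = q.2.
Proof. by split => [[/to_circleP h1 h2]//|[/to_circleP h1 h2]]; congr pair. Qed.

Lemma annulus_lift (R : realType) (T : normedModType R) (h : T -> annulus R) :
  (forall M : R, compact [set p : T | `|p| <= M]) -> continuous h ->
  exists2 A : T -> R * R, continuous A & forall p, to_annulus (A p) = h p.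
Proof.
move=> cT ch.
have [A cA hA] := circle_lift cT (continuous_compose ch (@continuous_fst _ _)).
exists (fun p => (A p, (h p).2)).
  by apply: continuous_pair => //; exact: (continuous_compose ch (@continuous_snd _ _)).
by move=> p; rewrite /to_annulus/= hA -surjective_pairing.
Qed.

(** * Differentials of lifted maps *)

Lemma is_diff_near_translate (R : realType) (E E' : normedModType R) (p : E)
    (F F' : E -> E') (D : E -> E') :
  (\forall q \near p, F q - F p = F' q - F' p) -> is_diff p F' D -> is_diff p F D.
Proof.
move=> FF' [dF' <-].
have FE : F \o shift p = cst (F p) + 'd F' p +o_ (0 : E) id.
  apply/eqaddoP => eps eps0.
  have /eqaddoP/(_ eps eps0) := diff_locally dF'.
  move: FF'; rewrite (near_shift (0 : E)) => FF'; apply: filterS2 FF' => h /=.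
  by rewrite subr0/= => e; rewrite !fctE/= !opprD !addrA e.
have dE := diff_unique (diff_continuous dF') FE.
split; last exact: dE.
by apply/diff_locallyP; rewrite dE; split => //; exact: diff_continuous.
Qed.

(* Two local lifts differ by a deck translation, so they share their differential. *)
Lemma local_lift_diff (R : realType) (E : normedModType R) (p : E)
    (F F' : E -> R * R) (D : E -> R * R) :
  {for p, continuous F} -> is_diff p F' D ->
  (\forall q \near p, to_annulus (F' q) = to_annulus (F q)) -> is_diff p F D.
Proof.
move=> cF dF' FF'; apply: is_diff_near_translate (dF').
have cF' : {for p, continuous F'} by apply: differentiable_continuous; case: dF'.
have cg : {for p, continuous (fun q => (F' q - F q).1)}.
  apply: (@continuous_comp _ _ _ (fun q => F' q - F q) fst); last exact: continuous_fst.
  by apply: continuousB.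
have n1 : \forall q \near p, `|(F' p - F p).1 - (F' q - F q).1| < 1.
  by apply: (@cvgr_dist_lt _ R^o) => //; exact: cg.
have /to_annulusP[i0 e0] := nbhs_singleton FF'.
apply: filterS2 FF' n1 => q /to_annulusP[iq eq] nq.
have : (F' p - F p).1 - (F' q - F q).1 = 0 by apply: int_lt1_eq0; rewrite // rpredB.
move: iq eq i0 e0 {nq}; case: (F q) (F' q) (F p) (F' p) => [a b] [a' b'] [c d] [c' d']/=.
move=> _ -> _ -> h; congr pair => /=.
have {}h : (c' - c) - (a' - a) = 0 :> R by exact: h.
by change (a - c = a' - c' :> R); lra.
Qed.

(** [tangent_map] only supplies local lifts, which vary with the point; a global continuous lift
    agrees with each of them up to a deck translation. *)
Lemma tangent_lift (R : realType) (E : normedModType R) (X : topologicalType)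
    (pX : E -> X) (f : X -> annulus R) (D : X -> E -> R * R) (F : E -> R * R) :
  tangent_map pX (@to_annulus R) f D -> continuous F ->
  (forall q, to_annulus (F q) = f (pX q)) -> forall p, is_diff p F (D (pX p)).
Proof.
move=> tD cF hF p; have [F' [nF' dF']] := tD p.
apply: local_lift_diff (dF') _; first exact: cF.
by apply: filterS nF' => q ->; rewrite hF.
Qed.

Lemma tangent_map_continuous (R : realType) (E : normedModType R) (X : topologicalType)
    (pX : E -> X) (f : X -> annulus R) (D : X -> E -> R * R) :
  tangent_map pX (@to_annulus R) f D -> continuous (fun p => f (pX p)).
Proof.
move=> tD p; have [F [nF [dF _]]] := tD p.
rewrite /continuous_at -(nbhs_singleton nF).
apply: cvg_trans; first by apply: near_eq_cvg nF.
apply: continuous_comp; first exact: differentiable_continuous.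
exact: continuous_to_annulus.
Qed.

Lemma locally_compact_balls (R : realType) (T : normedModType R) :
  (forall M : R, compact [set p : T | `|p| <= M]) -> locally_compact [set: T].
Proof.
move=> cT x _; rewrite withinET.
have cl : closed [set p : T | `|p| <= `|x| + 1].
  by apply: compact_closed (cT _); exact: norm_hausdorff.
exists [set p : T | `|p| <= `|x| + 1]; last by split; [exact: cT|].
near=> q; rewrite /= ltW// -ltrBlDl; apply: le_lt_trans (lerB_dist _ _) _.
by rewrite distrC; near: q; apply: cvgr_dist_lt => //; exact: cvg_id.
Unshelve. all: by end_near. Qed.

(** Continuity in [t] for the compact-open topology becomes joint continuity by uncurrying, the
    plane being locally compact; compact sets of the plane are sent to compact sets of the
    annulus. *)
Lemma joint_continuity (R : realType) (Y : topologicalType) (h : R -> annulus R -> Y) :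
  {within `[0, 1], continuous (h : R -> {compact-open, annulus R -> Y})} ->
  (forall t : R, t \in `[0, 1] -> continuous (fun p : R * R => h t (to_annulus p))) ->
  continuous (fun z : R * (R * R) => h (clamp 0 1 z.1) (to_annulus z.2)).
Proof.
move=> ch cht.
pose H (t : R) : {compact-open, (R * R)%type -> Y} := fun p => h (clamp 0 1 t)
    (to_annulus p).
have i01 (t : R) : clamp 0 1 t \in `[0, 1] by rewrite in_itv/= clamp_itv.
have cH : continuous H.
  move=> t; apply/compact_open_cvgP => K O cK oO HK.
  have /subspace_continuousP/(_ _ (i01 t))/compact_open_cvgP := ch.
  move=> /(_ (@to_annulus R @` K) O) nO.
  have /nO {}nO : compact (@to_annulus R @` K).
    by apply: continuous_compact => //; apply: continuous_subspaceT; exact: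
        continuous_to_annulus.
  have {}nO : \forall s \near clamp 0 1 t, s \in `[0, 1] ->
      [set h s x | x in @to_annulus R @` K] `<=` O.
    by apply: nO => // y [_ [p Kp <-] <-]; apply: HK; exists p.
  have n2 := @continuous_clamp R 0 1 t _ nO.
  apply: (@filterS R (nbhs t) _ _ _ _ n2) => s Bs y [p Kp <-].
  have {}Bs : [set h (clamp 0 1 s) x | x in @to_annulus R @` K] `<=` O := Bs (i01 s).
  by apply: Bs; exists (to_annulus p) => //; exists p.
rewrite (_ : (fun _ => _) = uncurry H); last by apply/funext => -[].
apply: continuous_uncurry cH _; first exact: (locally_compact_balls (@compact_ballR2 R)).
- exact: norm_hausdorff.
- by move=> t; exact: cht.
Qed.

(** * Lifting isotopies *)

Lemma to_annulusD (R : realType) (p : R * R) (k : R) :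
  k \is a Num.int -> to_annulus (p + (k, 0)) = to_annulus p.
Proof.
move=> kint; apply/to_annulusP; split; last exact: addr0.
by rewrite (_ : (p + (k, 0)).1 = p.1 + k)// addrAC subrr add0r.
Qed.

Lemma isotopy_lift (R : realType) ft Dt : @isotopy R ft Dt -> ft 0 = id ->
  exists2 F : R * (R * R) -> R * R, continuous F &
    [/\ forall t p, to_annulus (F (t, p)) = ft (clamp 0 1 t) (to_annulus p),
        forall p, F (0, p) = p &
        forall (t : R) (p : R * R) (k : R), k \is a Num.int ->
          F (t, p + (k, 0)) = F (t, p) + (k, 0)].
Proof.
move=> [dft cft cDt] ft0.
have [F0 cF0 hF0] := @annulus_lift R (R * (R * R))%type
    (fun z => ft (clamp 0 1 z.1) (to_annulus z.2)) (@compact_ballR3 R)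
    (joint_continuity cft (fun t t01 => tangent_map_continuous (dft t t01).2.1)).
have i0 (q : R * R) : to_annulus (F0 (0, q)) = to_annulus q.
  by rewrite hF0 /= clamp_id ?lexx ?ler01// ft0.
(* At time 0 the lift covers the identity, so it is a translation by an integer, removed below to
   start at the identity. *)
pose k0 := (F0 (0, (0, 0))).1.
have ik0 : k0 \is a Num.int.
  by have /to_annulusP[] := i0 (0, 0); rewrite subr0.
have F0q (q : R * R) : F0 (0, q) = q + (k0, 0).
  have /to_annulusP[_ e] := i0 q.
  have h : (F0 (0, q)).1 - q.1 = k0 - 0.
    apply: (@continuous_int_const R (R * R)%type (fun q => (F0 (0, q)).1 - q.1) _ _ q (0,
        0)).
    - apply: continuous_sub; last exact: continuous_fst.
      apply: (continuous_compose _ (continuous_compose cF0 (@continuous_fst _ _)) (f :=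
          fun q : R * R => (0 : R, q))).
      by apply: continuous_pair; [exact: continuous_const|exact: continuous_id].
    - by move=> x; have /to_annulusP[] := i0 x.
  move: e h; rewrite subr0; case: (F0 (0, q)) => [a b]; case: q => [x y]/= -> h.
  congr pair; last by change (y = y + 0 :> R); rewrite addr0.
  by change (a = x + k0 :> R); rewrite -h addrC subrK.
pose F z : R * R := F0 z + (- k0, 0).
have cF : continuous F by apply: continuous_add cF0 _; exact: continuous_const.
have hF z : to_annulus (F z) = ft (clamp 0 1 z.1) (to_annulus z.2).
  by rewrite to_annulusD ?rpredN.
have F00 (q : R * R) : F (0, q) = q.
  rewrite /F F0q; case: q => x y; congr pair; last by change (y + 0 + 0 = y :> R);
      rewrite !addr0.
  by change (x + k0 - k0 = x :> R); rewrite addrK.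
clearbody F; exists F => //; split => [t p||t p k kint]; [exact: hF|exact: F00|].
have c1 := continuous_compose cF (@continuous_fst _ _).
pose tr (z : R * (R * R)) := (z.1, z.2 + (k, 0)).
have ctr : continuous tr.
  apply: continuous_pair; first exact: continuous_fst.
  by apply: continuous_add; [exact: continuous_snd|exact: continuous_const].
have hz z : to_annulus (F (tr z)) = to_annulus (F z).
  by rewrite !hF /= to_annulusD.
(* The defect of commutation with the translation by [k] is a continuous integer, computed at time
   0, where [F] is the identity. *)
have h := @continuous_int_const R (R * (R * R))%type (fun z => (F (tr z)).1 - (F z).1)
  (continuous_sub (continuous_compose ctr c1) c1) (fun z => ((to_annulusP _ _).1 (hz
      z)).1) (t, p) (0, (0, 0)).
have /to_annulusP[_ e] := hz (t, p).
have {}h : (F (tr (t, p))).1 - (F (t, p)).1 = k.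
  by rewrite h /tr/= !F00; change (0 + k - 0 = k :> R); rewrite subr0 add0r.
move: e h; rewrite /tr/=; case: (F (t, p + (k, 0))) (F (t, p)) => [a b] [x y]/= -> h.
congr pair; last by change (y = y + 0 :> R); rewrite addr0.
by change (a = x + k :> R); rewrite -h addrC subrK.
Qed.

(** A local lift [G] of the inverse diffeomorphism makes [G \o F] a lift of the identity, so the
    chain rule gives a left inverse of the differential. *)
Lemma diff_lift_inj (R : realType) (f : annulus R -> annulus R)
    (D : annulus R -> R * R -> R * R) (F : R * R -> R * R) (p v : R * R) :
  C1_diffeo f -> {for p, continuous F} -> is_diff p F (D (to_annulus p)) ->
  (forall q, to_annulus (F q) = f (to_annulus q)) ->
  D (to_annulus p) v = 0 -> v = 0.
Proof.
move=> [g [fK gK _ [D' [tD' _]]]] cF dF hF Dv.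
have [G [nG dG]] := tD' (F p).
have dGF := @is_diff_comp _ _ _ _ F _ G _ p dF dG.
have cGF : {for p, continuous (G \o F)}.
  by apply: differentiable_continuous; exact: (@ex_diff _ _ _ _ _ _ _ dGF).
have did : is_diff p id (D' (to_annulus (F p)) \o D (to_annulus p)).
  apply: local_lift_diff (dGF) _; first exact: cvg_id.
  apply: (@filterS _ (nbhs p) _ _ _ _ (cF _ nG)) => q Gq.
  by rewrite /= (Gq : to_annulus (G (F q)) = _) hF fK.
have /(congr1 (fun h => h v)) := etrans (esym (@diff_val _ _ _ _ _ _ _ did)) (@diff_val _
    _ _ _ _ _ _ (is_diff_id p)).
rewrite /= Dv => <-.
case: dG => _ <-; exact: linear0.
Qed.

(** * Angles of secants *)

Lemma is_diff_fst (R : realType) (p : R * R) : is_diff p (@fst R R) fst.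
Proof.
split; first by apply: linear_differentiable => x; exact: cvg_fst.
by rewrite diff_lin// => x; exact: cvg_fst.
Qed.

Lemma is_diff_snd (R : realType) (p : R * R) : is_diff p (@snd R R) snd.
Proof.
split; first by apply: linear_differentiable => x; exact: cvg_snd.
by rewrite diff_lin// => x; exact: cvg_snd.
Qed.

Lemma is_diff_is_derive (R : realType) (s : R) (F : R -> R) (D : R -> R) :
  is_diff s F D -> is_derive s 1 F (D 1).
Proof.
by move=> [dF <-]; split; [exact: diff_derivable|rewrite deriveE].
Qed.

Lemma is_diff_derive1 (R : realType) (s : R) (F : R -> R * R) (D : R -> R * R) :
  is_diff s F D -> is_derive s 1 (fun x => (F x).1) (D 1).1.
Proof.
move=> dF; exact: (is_diff_is_derive (@is_diff_comp _ _ _ _ F _ _ _ s dF (is_diff_fst _))).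
Qed.

Lemma is_diff_derive2 (R : realType) (s : R) (F : R -> R * R) (D : R -> R * R) :
  is_diff s F D -> is_derive s 1 (fun x => (F x).2) (D 1).2.
Proof.
move=> dF; exact: (is_diff_is_derive (@is_diff_comp _ _ _ _ F _ _ _ s dF (is_diff_snd _))).
Qed.

(** Scalar-valued, because the mean value theorem is applied to each coordinate of the plane curve
    separately; the value at [u = 0] is the derivative. *)
Definition secant (R : realType) (g dg : R * R -> R) (t s u : R) : R :=
  if u == 0 then dg (t, s) else (g (t, s + u) - g (t, s)) / u.

Lemma secant_continuous (R : realType) (T : topologicalType) (g dg : R * R -> R)
    (t s u : T -> R) :
  continuous g -> continuous dg ->
  (forall a b : R, is_derive b 1 (fun x : R => g (a, x)) (dg (a, b))) ->
  continuous t -> continuous s -> continuous u -> (forall z, 0 <= u z) ->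
  continuous (fun z => secant g dg (t z) (s z) (u z)).
Proof.
move=> cg cdg hd ct cs cu u_ge0 z0.
have [u0|u0] := eqVneq (u z0) 0; last first.
  pose q z := (g (t z, s z + u z) - g (t z, s z)) / u z.
  have qz : \forall z \near z0, q z = secant g dg (t z) (s z) (u z).
    have un : \forall z \near z0, u z != 0 by apply: (cvgr_neq0 (u z0) (cu z0) u0).
    by apply: filterS un => z uz; rewrite /secant (negbTE uz).
  rewrite /continuous_at -(nbhs_singleton qz).
  apply: cvg_trans; first by apply: near_eq_cvg qz.
  apply: cvgM; last by apply: cvgV => //; exact: cu.
  apply: cvgB.
    apply: (continuous_compose (continuous_pair ct (continuous_add cs cu)) cg).
  exact: (continuous_compose (continuous_pair ct cs) cg).
(* Mean value theorem: the difference quotient is a derivative at an intermediate point. The chosen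
   [r] need not be continuous, but it is bounded, so [r z * u z] still tends to 0 where [u]
   vanishes. *)
have /choice[r hr] : forall z, exists r, 0 <= r <= 1 /\
    secant g dg (t z) (s z) (u z) = dg (t z, s z + r * u z).
  move=> z; have [uz|uz] := eqVneq (u z) 0.
    by exists 0; rewrite lexx ler01 /secant uz eqxx mulr0 addr0.
  have uz0 : 0 < u z by rewrite lt_neqAle eq_sym uz u_ge0.
  have cw : {within `[s z, s z + u z], continuous (fun x => g (t z, x))}.
    apply: continuous_subspaceT.
    exact: (continuous_compose (continuous_pair (@continuous_const _ _ (t z))
        (@continuous_id _)) cg).
  have suz : s z < s z + u z by rewrite ltrDl.
  have [c] := MVT suz (fun x _ => hd (t z) x) cw.
  rewrite in_itv/= => /andP[sc cu'] hc.
  exists ((c - s z) / u z); split.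
    by rewrite divr_ge0 ?subr_ge0 ?(ltW sc)//= ler_pdivrMr// mul1r lerBlDl ltW.
  rewrite divfK// [_ + (c - _)]addrC subrK /secant (negbTE uz) hc.
  by rewrite addrAC subrr add0r mulfK.
rewrite (_ : (fun _ => _) = fun z => dg (t z, s z + r z * u z)); last first.
  by apply/funext => z; have [] := hr z.
suff cru : r z * u z @[z --> z0] --> r z0 * u z0.
  apply: (@continuous_comp _ _ _ (fun z => (t z, s z + r z * u z)) dg); last exact: cdg.
  exact: (cvg_pair (ct z0) (cvgD (cs z0) cru)).
rewrite u0 mulr0; apply/(@cvgr0Pnorm_lt _ R^o) => eps eps0.
have un : \forall z \near z0, `|u z| < eps.
  by have := cu z0; rewrite /continuous_at u0 => /(@cvgr0Pnorm_lt _ R^o)/(_ eps eps0).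
apply: filterS un => z; apply: le_lt_trans.
have [/andP[r0 r1] _] := hr z.
by rewrite normrM ler_piMl// ger0_norm.
Qed.

(** The secant divided by [u] extends continuously to the tangent vector at [u = 0] and never
    vanishes, so it has an angle over all of space once [u] is clamped to [[0, 1]]. Dividing by
    [u > 0] does not change the direction. *)
Lemma secant_angle (R : realType) (G dG : R * R -> R * R) :
  continuous G -> continuous dG ->
  (forall t s : R, is_derive s 1 (fun x : R => (G (t, x)).1) (dG (t, s)).1) ->
  (forall t s : R, is_derive s 1 (fun x : R => (G (t, x)).2) (dG (t, s)).2) ->
  (forall z, dG z != 0) ->
  (forall t s u : R, 0 < u <= 1 -> G (t, s + u) != G (t, s)) ->
  exists2 A : R * (R * R) -> R, continuous A &
    (forall t s, exists2 r, 0 < r & dG (t, s) = r *: dir (A (t, (s, 0)))) /\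
    (forall t s u : R, 0 < u <= 1 -> exists2 r, 0 < r &
      G (t, s + u) - G (t, s) = r *: dir (A (t, (s, u)))).
Proof.
move=> cG cdG hd1 hd2 dG0 GI.
have cf f := continuous_compose f (@continuous_fst R R).
have cs f := continuous_compose f (@continuous_snd R R).
pose cl (z : R * (R * R)) := clamp 0 1 z.2.2.
pose V z := (secant (fun z => (G z).1) (fun z => (dG z).1) z.1 z.2.1 (cl z),
             secant (fun z => (G z).2) (fun z => (dG z).2) z.1 z.2.1 (cl z)).
have V0 t s : V (t, (s, 0)) = dG (t, s).
  by rewrite /V /secant /cl/= clamp_id ?lexx ?ler01// eqxx; case: (dG _).
have Vu t s u : 0 < clamp 0 1 u ->
    V (t, (s, u)) = (clamp 0 1 u)^-1 *: (G (t, s + clamp 0 1 u) - G (t, s)).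
  move=> u0; rewrite /V /secant /cl/= (gt_eqF u0).
  by congr pair; rewrite mulrC.
have [||A cA hA] := @angle_lift R _ V (@compact_ballR3 R).
- have c2 : continuous (fun z : R * (R * R) => z.2) := @continuous_snd _ _.
  have c21 := continuous_compose c2 (@continuous_fst _ _).
  have ccl := continuous_compose (continuous_compose c2 (@continuous_snd _ _))
      (@continuous_clamp R 0 1).
  have cl0 z : 0 <= cl z by have /andP[] := clamp_itv z.2.2 (@ler01 R).
  by apply: continuous_pair; apply: secant_continuous => //;
    by [exact: cf|exact: cs|exact: continuous_fst].
- move=> [t [s u]].
  have /andP[c0 c1] := clamp_itv u (@ler01 R).
  have [u0|u0] := eqVneq (clamp 0 1 u) 0.
    have -> : V (t, (s, u)) = V (t, (s, 0)); last by rewrite V0.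
    by rewrite /V /secant /cl/= u0 eqxx clamp_id ?lexx ?ler01// eqxx.
  have up : 0 < clamp 0 1 u by rewrite lt_neqAle eq_sym u0.
  rewrite Vu//; apply: contra_neq (GI t s (clamp 0 1 u) _); last by rewrite up c1.
  by move=> /eqP; rewrite scaler_eq0 invr_eq0 (negbTE u0)/= subr_eq0 => /eqP.
exists A => //; split=> [t s|t s u /andP[u0 u1]].
  by rewrite -V0; exact: hA.
have [r r0 hr] := hA (t, (s, u)).
have cu : clamp 0 1 u = u by rewrite clamp_id// ltW.
exists (u * r); first exact: mulr_gt0.
by rewrite -scalerA -hr Vu ?cu// scalerA divff ?gt_eqF// scale1r.
Qed.

(** * Curves in the annulus *)

Lemma compact_circle (R : realType) : compact [set: circle R].
Proof.
rewrite (_ : setT = @to_circle R @` `[0, 1]).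
  apply: continuous_compact (@segment_compact R 0 1).
  by apply: continuous_subspaceT; exact: continuous_to_circle.
apply/seteqP; split => // c _.
pose x := repr c; exists (x - (Num.floor x)%:~R).
  rewrite /= in_itv/= subr_ge0 ge_floor/= lerBlDl ltW//.
  by rewrite -[1]/(1%:~R) -intrD floorD1_gt.
by rewrite to_circleDint ?rpredN ?intr_int// to_circle_repr.
Qed.

(** The annulus is injected continuously into a normed space, where compact sets are closed, and
    closedness is pulled back. *)
Lemma compact_closed_annulus (R : realType) (K : set (annulus R)) :
  compact K -> closed K.
Proof.
move=> cK.
pose e (z : annulus R) : (R * R) * R := (circle_dir z.1, z.2).
have ce : continuous e.
  apply: continuous_pair; last exact: continuous_snd.
  exact: (continuous_compose (@continuous_fst _ _) (@continuous_circle_dir R)).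
have ie : injective e.
  by move=> [x y] [x' y'] [h1 h2 ->]; congr pair; apply: circle_dir_inj; exact:
      injective_projections.
have -> : K = e @^-1` (e @` K).
  apply/seteqP; split => [z Kz|z [z' Kz' /ie <-]//]; by exists z.
apply: (closed_comp (fun z _ => ce z)).
apply: compact_closed; first exact: norm_hausdorff.
by apply: continuous_compact cK; exact: continuous_subspaceT.
Qed.

Lemma closed_curve_image (R : realType) (gamma : circle R -> annulus R) (C : set (circle
    R)) :
  continuous gamma -> closed C -> closed (gamma @` C).
Proof.
move=> cg cC; apply: compact_closed_annulus; apply: continuous_compact.
  exact: continuous_subspaceT.
exact: subclosed_compact cC (@compact_circle R) _.
Qed.

(** An injective continuous [gamma] on the compact circle is a closed map, so [h] read in the
    parameter of the curve is continuous and lifts to the line. *)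
Lemma curve_conjugacy (R : realType) (gamma : circle R -> annulus R) (h : R -> annulus R) :
  continuous gamma -> injective gamma -> continuous h -> (forall s, range gamma (h s)) ->
  exists2 ph : R -> R, continuous ph & forall s, gamma (to_circle (ph s)) = h s.
Proof.
move=> cg ig ch rh.
have /choice[q hq] : forall s, exists x, gamma x = h s by move=> s; have [x _ <-] := rh
    s; exists x.
have cq : continuous q.
  apply/continuous_closedP => C cC.
  rewrite (_ : q @^-1` C = h @^-1` (gamma @` C)).
    by apply: closed_comp; [move=> z _; exact: ch|exact: closed_curve_image].
  apply/seteqP; split => s; first by move=> Cs; exists (q s).
  move=> [x Cx e]; have /ig qs : gamma (q s) = gamma x by rewrite hq.
  by rewrite /preimage/= qs.
have [ph cph hph] := circle_lift (@compact_ballR R) cq.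
by exists ph => // s; rewrite hph hq.
Qed.

Lemma periodic_shift_int (R : realType) (c : R -> R * R) (d : R) :
  (forall s, c (s + 1) = c s + (d, 0)) ->
  forall (s k : R), k \is a Num.int -> c (s + k) = c s + (k * d, 0).
Proof.
move=> h s k /intrP[m ->].
have hn s' (n : nat) : c (s' + n%:R) = c s' + (n%:R * d, 0).
  elim: n => [|n ih].
    by rewrite addr0 mul0r; case: (c s') => a b; congr pair; exact: esym (addr0 _).
  rewrite -natr1 addrA h ih; case: (c s') => a b; congr pair.
    by change (a + n%:R * d + d = a + (n%:R + 1) * d :> R); ring.
  by change (b + 0 + 0 = b + 0 :> R); rewrite addr0.
case: m => n; first exact: hn.
rewrite NegzE mulrNz; have := hn (s - n.+1%:~R) n.+1; rewrite subrK => ->.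
case: (c _) => a b; congr pair.
  by change (a = a + n.+1%:R * d + - n.+1%:~R * d :> R); rewrite mulNr addrK.
by change (b = b + 0 + 0 :> R); rewrite !addr0.
Qed.

(** The lift closes up in the plane, where it is contracted linearly to the origin. *)
Lemma null_homotopic (R : realType) (gamma : circle R -> annulus R) (c : R -> R * R) :
  continuous c -> (forall s, to_annulus (c s) = gamma (to_circle s)) ->
  (forall s, c (s + 1) = c s) -> homotopic_to_point gamma.
Proof.
move=> cc hc pc.
have pk (s k : R) : k \is a Num.int -> c (s + k) = c s.
  move=> ik; rewrite (@periodic_shift_int _ c 0)//.
    by rewrite mulr0; case: (c s) => a b; congr pair; exact: addr0.
  by move=> s'; rewrite pc; case: (c s') => a b; congr pair; exact: esym (addr0 _).
pose cc' (x : circle R) := c (repr x).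
have ccE s : cc' (to_circle s) = c s.
  rewrite /cc' -[repr _](subrK s) addrC pk//.
  by apply/to_circleP; rewrite to_circle_repr.
have ccc : continuous cc'.
  by apply: continuous_circle; rewrite (_ : (fun _ => _) = c)//; apply/funext => s;
      rewrite ccE.
exists (fun z => to_annulus ((1 - z.1) *: cc' z.2)), (to_annulus 0); split.
- apply: continuous_subspaceT.
  apply: (continuous_compose (f := fun z : R * circle R => (1 - z.1) *: cc' z.2)); last
      exact: continuous_to_annulus.
  apply: continuous_scale; last exact: (continuous_compose (@continuous_snd _ _) ccc).
  by apply: continuous_sub; [exact: continuous_const|exact: continuous_fst].
- by move=> s; rewrite subr0 scale1r -[s]to_circle_repr ccE hc.
- by move=> s; rewrite subrr scale0r.
Qed.

Lemma curve_lift (R : realType) (gamma : circle R -> annulus R) :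
  C1_essential_curve gamma ->
  exists (c c' : R -> R * R) (d : R),
    [/\ [/\ continuous c, continuous c', d \is a Num.int & d != 0],
        forall s, to_annulus (c s) = gamma (to_circle s),
        forall s, exists2 D, is_diff s c D & D 1 = c' s,
        forall s, c' s != 0 &
        forall s, c (s + 1) = c s + (d, 0) /\ c' (s + 1) = c' s].
Proof.
move=> [[cg ig eg] [D [tD cD] D0]].
have [c cc hc] := annulus_lift (@compact_ballR R) (continuous_compose
    (@continuous_to_circle R) cg).
have per s : to_annulus (c (s + 1)) = to_annulus (c s).
  by rewrite !hc to_circleDint ?rpred1.
have c1 := continuous_compose cc (@continuous_fst _ _).
have cS : continuous (fun s : R => s + 1).
  by apply: continuous_add; [exact: continuous_id|exact: continuous_const].
pose d := (c (0 + 1)).1 - (c 0).1.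
have dE s : c (s + 1) = c s + (d, 0).
  have /to_annulusP[_ e] := per s.
  have h := continuous_int_const (continuous_sub (continuous_compose cS c1) c1)
    (fun z => ((to_annulusP _ _).1 (per z)).1) s 0.
  move: e; rewrite /= in h *; rewrite /d -h; case: (c (s + 1)) (c s) => [a b] [x y]/= ->.
  congr pair; last by change (y = y + 0 :> R); rewrite addr0.
  by change (a = x + (a - x) :> R); rewrite addrC subrK.
exists c, (fun s => D (to_circle s) 1), d; split => //.
- split => //.
  + exact: (continuous_compose (@continuous_to_circle R) (cD 1)).
  + by have /to_annulusP[] := per 0.
  (* This is where essentiality is used: a zero horizontal period would make the curve
     contractible. *)
  + apply/eqP => d0; apply: eg; apply: (null_homotopic cc hc) => s.
    by rewrite dE d0; case: (c s) => x y; congr pair; exact: addr0.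
- by move=> s; exists (D (to_circle s)) => //; exact: (tangent_lift tD cc hc).
- by move=> s; split; [exact: dE|rewrite to_circleDint ?rpred1].
Qed.

(** * Dynamics of the tangent angle *)

(** Passes from secants to the tangent: [e] is constantly 0 on [(0, 1]], and its value at 0 follows
    by continuity, with no integrality known there. *)
Lemma int_valued_at0 (R : realType) (e : R -> R) : continuous e ->
  (forall u, 0 < u <= 1 -> e u \is a Num.int) -> e 1 = 0 -> e 0 = 0.
Proof.
move=> ce ie e1.
have h u : 0 < u <= 1 -> e u = 0.
  move=> /andP[u0 u1].
  have := @continuous_int_const R R (fun x => e (clamp u 1 x))
    (continuous_compose (@continuous_clamp R u 1) ce) _ u 1.
  rewrite !clamp_id ?lexx ?u1// e1; apply => x; apply: ie.
  by have /andP[h1 h2] := clamp_itv x u1; rewrite h2 (lt_le_trans u0).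
apply/eqP; rewrite -normr_eq0; apply/negPn/negP => e0.
have e00 : 0 < `|e 0| by rewrite lt_neqAle eq_sym e0 normr_ge0.
have nh : \forall u \near (0 : R), `|e 0 - e u| < `|e 0|.
  exact: ((cvgrPdist_lt _ _).1 (ce 0) _ e00).
have [r /= r0 hr] := (nbhs_ballP _ _).1 nh.
pose u := Num.min (r / 2) 1.
have u0 : 0 < u by rewrite lt_min divr_gt0//= ltr01.
have u1 : u <= 1 by rewrite ge_min lexx orbT.
have ur : ball (0 : R) r u.
  rewrite /ball/= sub0r normrN gtr0_norm// gt_min ltr_pdivrMr// ltr_pMr// ltr1n.
  by rewrite orTb.
by have := hr _ ur; rewrite /= (h u) ?u0// subr0 ltxx.
Qed.

Lemma pos_scale_dir_int (R : realType) (v : R * R) (a b r r' : R) :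
  0 < r -> 0 < r' -> v = r *: dir a -> v = r' *: dir b -> a - b \is a Num.int.
Proof.
move=> r0 r'0 -> h; apply: (@dir_scale_int _ _ _ (r' / r)); first exact: divr_gt0.
by rewrite mulrC -scalerA -h scalerA mulVf ?scale1r// gt_eqF.
Qed.

Lemma tangent_linear (R : realType) (E E' : normedModType R) (X Y : topologicalType)
    (pX : E -> X) (pY : E' -> Y) f D p : tangent_map pX pY f D ->
  forall (a b : R) u v, D (pX p) (a *: u + b *: v) = a *: D (pX p) u + b *: D (pX p) v.
Proof.
by move=> tD a b u v; have [F [_ [dF <-]]] := tD p; rewrite linearD !linearZ.
Qed.

(** For [v != 0] the set inside [oriented_angle] is inhabited, so [xget] returns a true angle and
    not its default 0. *)
Lemma oriented_angle_dir (R : realType) (v : R * R) (w : R) : v != 0 ->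
  to_circle w = oriented_angle (chi R) v -> exists2 r, 0 < r & v = r *: dir w.
Proof.
move=> v0; rewrite /oriented_angle; set P := [set a | _].
have [a [r [r0 hr]]] := dir_exists v0.
have : P (xget 0 P) by apply: (@xgetPex _ 0 P); exists a; exists r.
move: (xget 0 P) => b [r' r'0 hb] /to_circleP wb.
by exists r' => //; rewrite hb -/(dir b) -[w](subrK b) addrC dirDint.
Qed.

(* [2 (x t - w t)] is an integer at one time iff it is at every time, since
   collinearity of the two tangent vectors is preserved by the tangent maps. *)
Lemma torsion_push (R : realType) (x w : R -> R) (n w0 : R) :
  continuous x -> continuous w -> n \is a Num.int -> 2 * w 0 \is a Num.int ->
  (forall t t', 2 * (x t - w t) \is a Num.int -> 2 * (x t' - w t') \is a Num.int) ->
  w 1 < w 0 -> x 0 <= n / 2 -> x 1 < n / 2.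
Proof.
move=> cx cw nint w0int hxw w10 x0.
pose g t := 2 * (x t - w t).
have cg : continuous g.
  by apply: continuous_mul; [exact: continuous_const|exact: continuous_sub].
(* The barrier is read relative to [w]: it is the integer [n - 2 * w 0]. If [g] crossed it, [g]
   would be an integer at that time, hence at all times, hence constant. The strict drop of [w]
   makes the final inequality strict. *)
suff g1 : g 1 <= n - 2 * w 0 by rewrite /g in g1; lra.
rewrite leNgt; apply/negP => h.
have [|z hz] := @IVT_value R g 0 1 (n - 2 * w 0) cg; first by rewrite (ltW h) andbT /g; lra.
have ig t : g t \is a Num.int by apply: (hxw z); rewrite -/(g z) hz rpredB.
have := continuous_int_const cg ig 0 1; rewrite {1}/g; lra.
Qed.

Lemma curve_isotopy_angle (R : realType) ft Dt (F : R * (R * R) -> R * R)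
    (gamma : circle R -> annulus R) (c c' : R -> R * R) (d : R) :
  @isotopy R ft Dt -> continuous F ->
  (forall t p, to_annulus (F (t, p)) = ft (clamp 0 1 t) (to_annulus p)) ->
  (forall (t : R) (p : R * R) (k : R), k \is a Num.int ->
     F (t, p + (k, 0)) = F (t, p) + (k, 0)) ->
  injective gamma -> continuous c -> continuous c' -> d \is a Num.int -> d != 0 ->
  (forall s, to_annulus (c s) = gamma (to_circle s)) ->
  (forall s : R, exists2 D, is_diff s c D & D 1 = c' s) ->
  (forall s, c' s != 0) -> (forall s, c (s + 1) = c s + (d, 0)) ->
  exists2 A : R * (R * R) -> R, continuous A &
    (forall t s : R, exists2 r : R, 0 < r &
      Dt (clamp 0 1 t) (to_annulus (c s)) (c' s) = r *: dir (A (t, (s, 0)))) /\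
    (forall t s u : R, 0 < u <= 1 -> exists2 r : R, 0 < r &
      F (t, c (s + u)) - F (t, c s) = r *: dir (A (t, (s, u)))).
Proof.
move=> [dft cft cDt] cF hF trF ig cc cc' dint d0 hc dc c'0 pc.
have i01 (t : R) : clamp 0 1 t \in `[0, 1] by rewrite in_itv/= clamp_itv.
have dF t p : is_diff p (fun q => F (t, q)) (Dt (clamp 0 1 t) (to_annulus p)).
  apply: (tangent_lift (dft _ (i01 t)).2.1); last by move=> q; exact: hF.
  by apply: (continuous_compose (f := fun q : R * R => (t, q))) cF;
    apply: continuous_pair; [exact: continuous_const|exact: continuous_id].
have cDz v : continuous (fun z : R * (R * R) => Dt (clamp 0 1 z.1) (to_annulus z.2) v).
  apply: (joint_continuity (h := fun t x => Dt t x v) (cDt v)) => t t01.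
  exact: (continuous_compose (@continuous_to_annulus R) ((dft t t01).2.2 v)).
pose G (z : R * R) := F (z.1, c z.2).
pose dG (z : R * R) := Dt (clamp 0 1 z.1) (to_annulus (c z.2)) (c' z.2).
have czc : continuous (fun z : R * R => (z.1, c z.2)).
  apply: continuous_pair; first exact: continuous_fst.
  exact: (continuous_compose (@continuous_snd _ _) cc).
have cG : continuous G by exact: (continuous_compose czc cF).
have cdG : continuous dG.
  (* Continuity of the tangent maps is known for fixed vectors only, so [c'] is decomposed in the
     standard basis. *)
  have -> : dG = fun z => (c' z.2).1 *: Dt (clamp 0 1 z.1) (to_annulus (c z.2)) (1, 0)
                        + (c' z.2).2 *: Dt (clamp 0 1 z.1) (to_annulus (c z.2)) (0, 1).
    apply/funext => z; rewrite -(tangent_linear _ (dft _ (i01 z.1)).2.1) /dG.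
    congr (Dt _ _ _); case: (c' z.2) => a b; congr pair.
      by change (a = a * 1 + b * 0 :> R); rewrite mulr1 mulr0 addr0.
    by change (b = a * 0 + b * 1 :> R); rewrite mulr1 mulr0 add0r.
  have c2 := continuous_compose (@continuous_snd R R) cc'.
  by apply: continuous_add; apply: continuous_scale;
    by [exact: (continuous_compose c2 (@continuous_fst _ _))
       |exact: (continuous_compose c2 (@continuous_snd _ _))
       |exact: (continuous_compose czc (cDz _))].
have dGs (t s : R) : exists2 D, is_diff s (fun x => G (t, x)) D & D 1 = dG (t, s).
  have [D dD D1] := dc s.
  exists (Dt (clamp 0 1 t) (to_annulus (c s)) \o D); last by rewrite /= D1.
  exact: (@is_diff_comp _ _ _ _ c _ (fun q => F (t, q)) _ s dD (dF t (c s))).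
have [||||A cA [hA0 hA]] := @secant_angle R G dG cG cdG.
- by move=> t s; have [D dD <-] := dGs t s; exact: is_diff_derive1 dD.
- by move=> t s; have [D dD <-] := dGs t s; exact: is_diff_derive2 dD.
- move=> [t s]; apply: contra_neq (c'0 s) => h.
  apply: (diff_lift_inj (dft _ (i01 t)).1 _ (dF t (c s))) h; last by move=> q; exact: hF.
  by apply: differentiable_continuous; case: (dF t (c s)).
(* Injectivity of the isotopy and of [gamma] makes [u] an integer, so [u = 1]; but that secant is
   [(d, 0)], which is nonzero. *)
- move=> t s u /andP[u0 u1]; apply/eqP => h.
  have : to_annulus (G (t, s + u)) = to_annulus (G (t, s)) by rewrite h.
  rewrite /G/= !hF; have [[g [fK _ _ _]] _] := dft _ (i01 t).
  move=> /(can_inj fK); rewrite !hc => /ig/to_circleP; rewrite addrAC subrr add0r => uint.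
  have u1' : u = 1.
    apply/eqP; rewrite eq_le u1 leNgt; apply/negP => ul.
    by have := int_lt1_eq0 uint; rewrite gtr0_norm// => /(_ ul) e; rewrite e ltxx in u0.
  move: h; rewrite /G/= u1' pc trF//; case: (F _) => a b [h _].
  have had : a + d = a :> R by exact: h.
  by move: d0; rewrite (_ : d = 0) ?eqxx//; apply: (addrI a); rewrite addr0.
by exists A.
Qed.

(** A continuous injection of the line is monotone, and [ph 1 = ph 0 + 1] decides the direction. *)
Lemma lift_increasing (R : realType) (ph : R -> R) : continuous ph -> injective ph ->
  (forall s, ph (s + 1) = ph s + 1) -> {mono ph : x y / x <= y}.
Proof.
move=> cph iph pph x y.
apply: (@itv_continuous_inj_le R ph `]-oo, +oo[); rewrite ?in_itv//.
- have h1 : ph 0 < ph 1 by rewrite -[1]add0r pph ltrDl.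
  by exists 0, 1; rewrite !in_itv/= ltr01 (ltW h1).
- exact: continuous_subspaceT.
- by move=> z t _ _; exact: iph.
Qed.

Lemma angle_dynamics (R : realType) (f : annulus R -> annulus R)
    (gamma : circle R -> annulus R) (c c' : R -> R * R) (d : R) :
  negative_torsion_map f -> invariant_curve f gamma ->
  continuous gamma -> injective gamma ->
  continuous c -> continuous c' -> d \is a Num.int -> d != 0 ->
  (forall s, to_annulus (c s) = gamma (to_circle s)) ->
  (forall s : R, exists2 D, is_diff s c D & D 1 = c' s) ->
  (forall s, c' s != 0) -> (forall s, c (s + 1) = c s + (d, 0)) ->
  exists ph a : R -> R,
    [/\ continuous ph /\ (forall s, ph (s + 1) = ph s + 1),
        continuous a /\ (forall s, a (s + 1) = a s),
        forall s, gamma (to_circle (ph s)) = f (gamma (to_circle s)),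
        forall s, exists2 r : R, 0 < r & c' s = r *: dir (a s) &
        forall s n, n \is a Num.int -> a s <= n / 2 -> a (ph s) < n / 2].
Proof.
move=> [df [ft [Dt [iso ft0 ft1 tors]]]] inv cg ig cc cc' dint d0 hc dc c'0 pc.
have [F cF [hF F0 trF]] := isotopy_lift iso ft0.
have [dft _ _] := iso.
have i01 (t : R) : clamp 0 1 t \in `[0, 1] by rewrite in_itv/= clamp_itv.
have i0 : (0 : R) \in `[0, 1] by rewrite in_itv/= lexx ler01.
have i1 : (1 : R) \in `[0, 1] by rewrite in_itv/= lexx ler01.
have cl0 : clamp 0 1 0 = 0 :> R by rewrite clamp_id ?lexx ?ler01.
have cl1 : clamp 0 1 1 = 1 :> R by rewrite clamp_id ?lexx ?ler01.
have Dt0 p : Dt 0 (to_annulus p) = id.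
  have [_ [tD0 _]] := dft 0 i0; rewrite ft0 in tD0.
  have did : is_diff p id (Dt 0 (to_annulus p)).
    by apply: (tangent_lift tD0) => // x; exact: continuous_id.
  by rewrite -(@diff_val _ _ _ _ _ _ _ did) (@diff_val _ _ _ _ _ _ _ (is_diff_id p)).
have [A cA [hA0 hA]] :=
  curve_isotopy_angle iso cF hF trF ig cc cc' dint d0 hc dc c'0 pc.
have A1 t s : A (t, (s, 1)) = A (0, (0, 1)).
  pose g (z : R * R) := A (z.1, (z.2, 1)) - A (0, (0, 1)).
  have gint z : g z \is a Num.int.
    have l1 : (0 : R) < (1 : R) <= 1 by rewrite ltr01 lexx.
    have e t' s' : F (t', c (s' + 1)) - F (t', c s') = (d, 0).
      by rewrite pc trF// addrC addKr.
    have [r r0] := hA z.1 z.2 1 l1; rewrite e => hr.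
    have [r' r'0] := hA 0 0 1 l1; rewrite e => hr'.
    exact: pos_scale_dir_int r0 r'0 hr hr'.
  have cg' : continuous g.
    apply: continuous_sub; last exact: continuous_const.
    exact: (continuous_compose (continuous_pair (@continuous_fst R R)
      (continuous_pair (@continuous_snd R R) (@continuous_const _ R 1))) cA).
  have := continuous_int_const cg' gint (t, s) (0, 0).
  by rewrite /g/= subrr => /subr0_eq.
have cAu (t s : R -> R) (u : R -> R) : continuous t -> continuous s -> continuous u ->
    continuous (fun x => A (t x, (s x, u x))).
  move=> ct cs cu.
  exact: (continuous_compose (continuous_pair ct (continuous_pair cs cu)) cA).
pose a s := A (0, (s, 0)).
have ca : continuous a.
  by apply: cAu; by [exact: continuous_const|exact: continuous_id].
have hf s : to_annulus (F (1, c s)) = f (gamma (to_circle s)) by rewrite hF cl1 ft1 hc.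
have [ph cph hph] : exists2 ph : R -> R, continuous ph &
    forall s, gamma (to_circle (ph s)) = to_annulus (F (1, c s)).
  apply: (curve_conjugacy cg ig).
    apply: (continuous_compose (f := fun s => F (1, c s))) (@continuous_to_annulus R).
    exact: (continuous_compose (continuous_pair (@continuous_const _ R 1) cc) cF).
  by move=> s; rewrite hf -inv; exists (gamma (to_circle s)) => //; exists (to_circle s).
pose m := (F (1, c 0)).1 - (c (ph 0)).1.
(* Both sides lift the same path in the annulus, so they differ by a fixed deck translation, which
   cancels in every secant. *)
have Fph s : F (1, c s) = c (ph s) + (m, 0).
  have e s' : to_annulus (F (1, c s')) = to_annulus (c (ph s')) by rewrite -hph hc.
  have h : (F (1, c s)).1 - (c (ph s)).1 = m.
    apply: (continuous_int_const (g := fun s => (F (1, c s)).1 - (c (ph s)).1)).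
      apply: continuous_sub; last exact: (continuous_compose (continuous_compose cph cc)
          (@continuous_fst _ _)).
      exact: (continuous_compose (continuous_compose (continuous_pair (@continuous_const
          _ R 1) cc) cF) (@continuous_fst _ _)).
    by move=> s'; have /to_annulusP[] := e s'.
  have /to_annulusP[_] := e s; move: h; case: (F (1, c s)) (c (ph s)) => [x y] [x' y']/=
      <- ->.
  by congr pair; [change (x = x' + (x - x') :> R); rewrite addrC subrK|exact: esym (addr0
      _)].
have ck := periodic_shift_int pc.
(* Computing [F (1, c (s + 1))] in two ways gives [(k - 1) * d = 0] for the increment [k] of [ph];
   here [d != 0] is essential. *)
have pph s : ph (s + 1) = ph s + 1.
  have k_int : ph (s + 1) - ph s \is a Num.int.
    by apply/to_circleP/ig; rewrite !hph !hf to_circleDint ?rpred1.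
  have cp : c (ph (s + 1)) = c (ph s) + ((ph (s + 1) - ph s) * d, 0).
    by rewrite -ck// [ph s + _]addrC subrK.
  have := Fph (s + 1); rewrite pc trF// Fph cp.
  case: (c (ph s)) => x y /(congr1 fst); set k := ph (s + 1) - ph s => h.
  have {}h : x + m + d = x + k * d + m :> R by exact: h.
  have : (k - 1) * d = 0 by lra.
  move/eqP; rewrite mulf_eq0 (negbTE d0) orbF subr_eq0 /k subr_eq => /eqP ->.
  by rewrite addrC.
have iph : injective ph.
  move=> s t st.
  have k_int : t - s \is a Num.int.
    apply/to_circleP/ig; have [[g [fK _ _ _]] _] := dft 1 i1.
    by apply: (can_inj fK); rewrite ft1 -!hf -!hph st.
  have ct : c t = c s + ((t - s) * d, 0) by rewrite -ck// [s + _]addrC subrK.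
  have := Fph t; rewrite ct trF ?rpredM// Fph -st.
  case: (c (ph s)) => x y /(congr1 fst); set k := t - s => h.
  have {}h : x + m + k * d = x + m :> R by exact: h.
  have : k * d = 0 by lra.
  by move/eqP; rewrite mulf_eq0 (negbTE d0) orbF subr_eq0 => /eqP ->.
have mph := lift_increasing cph iph pph.
exists ph, a; split => //.
- split => // s.
  (* The two secants coincide, so [e] is an integer for [u > 0]; it vanishes at [u = 1] because [A]
     is constant there. *)
  pose e u := A (0, (s + 1, u)) - A (0, (s, u)).
  have ce : continuous e.
    by apply: continuous_sub; apply: cAu; by [exact: continuous_const|exact: continuous_id].
  apply/eqP; rewrite -subr_eq0; apply/eqP; apply: (int_valued_at0 ce); last by rewrite /e
      !A1 subrr.
  move=> u u01; have [r r0 h] := hA 0 (s + 1) u u01; have [r' r'0 h'] := hA 0 s u u01.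
  apply: (pos_scale_dir_int r0 r'0 h); rewrite -h' addrAC !pc !F0.
  by rewrite opprD addrACA subrr addr0.
- by move=> s; rewrite hph hf.
- by move=> s; have [r r0 h] := hA0 0 s; exists r; rewrite // -h cl0 Dt0.
move=> s n nint asn.
have as1 : A (1, (s, 0)) = a (ph s).
  (* The image under [F] at time 1 of the secant of length [u] at [s] is the secant of length [w u]
     at [ph s]; since [ph] is increasing, [w u] stays in [(0, 1]]. *)
  pose w u := ph (s + u) - ph s.
  have cw : continuous w.
    apply: continuous_sub; last exact: continuous_const.
    apply: (continuous_compose _ cph (f := fun u => s + u)).
    by apply: continuous_add; [exact: continuous_const|exact: continuous_id].
  pose e u := A (1, (s, u)) - A (0, (ph s, w u)).
  have ce : continuous e.
    by apply: continuous_sub; apply: cAu; by [exact: continuous_const|exact: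
        continuous_id|exact: cw].
  have w1 : w 1 = 1 by rewrite /w pph addrAC subrr add0r.
  have w0 : w 0 = 0 by rewrite /w addr0 subrr.
  apply/eqP; rewrite -subr_eq0; apply/eqP.
  rewrite (_ : A _ - a _ = e 0); last by rewrite /e w0.
  apply: (int_valued_at0 ce); last by rewrite /e w1 !A1 subrr.
  move=> u /andP[u0 u1].
  have wu : 0 < w u <= 1.
    rewrite subr_gt0 lerBlDl -pph mph lerD2l u1 andbT.
    by rewrite lt_neqAle (inj_eq iph) -{1}[s]addr0 (inj_eq (addrI s)) eq_sym gt_eqF//=
        mph lerDl ltW.
  have [r r0 h] := hA 1 s u (introT andP (conj u0 u1)).
  have [r' r'0 h'] := hA 0 (ph s) (w u) wu.
  apply: (pos_scale_dir_int r0 r'0 h); rewrite -h' !F0 !Fph /w [ph s + _]addrC subrK.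
  by rewrite opprD addrACA subrr addr0.
have [tau [w [cw hw ->]] tau0] := tors (to_annulus (c s)).
have chi0 : chi R != 0 by apply/eqP => -[/eqP]; rewrite oner_eq0.
have DI t v : Dt (clamp 0 1 t) (to_annulus (c s)) v = 0 -> v = 0.
  have dF : is_diff (c s) (fun q => F (t, q)) (Dt (clamp 0 1 t) (to_annulus (c s))).
    apply: (tangent_lift (dft _ (i01 t)).2.1); last by move=> q; exact: hF.
    exact: (continuous_compose (continuous_pair (@continuous_const _ R t) (@continuous_id
        _)) cF).
  apply: (diff_lift_inj (dft _ (i01 t)).1 _ dF) => [|q]; last exact: hF.
  by apply: differentiable_continuous; case: dF.
have Dchi0 t : Dt (clamp 0 1 t) (to_annulus (c s)) (chi R) != 0.
  by apply: contra_neq chi0; exact: DI.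
have wdir t : exists2 r, 0 < r & Dt (clamp 0 1 t) (to_annulus (c s)) (chi R) = r *: dir
    (w (clamp 0 1 t)).
  by apply: oriented_angle_dir; [exact: Dchi0|exact: hw (i01 t)].
have cwc : continuous (fun t => w (clamp 0 1 t)).
  move=> t; have /subspace_continuousP/(_ (clamp 0 1 t) (i01 t)) := cw.
  move=> h U /h nU; have nU' := @continuous_clamp R 0 1 t _ nU.
  by apply: (@filterS _ (nbhs t) _ _ _ _ nU') => x; exact (fun h => h (i01 x)).
have w10 : w (clamp 0 1 1) < w (clamp 0 1 0) by rewrite cl0 cl1 -subr_lt0.
have wint : 2 * w (clamp 0 1 0) \is a Num.int.
  have [r r0] := wdir 0; rewrite cl0 Dt0 => h.
  have d00 : chi R = 1 *: dir 0 by rewrite scale1r dirE mulr0 sin0 cos0 oppr0.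
  rewrite rpredM//; first by rewrite -[2]/(2%:~R) intr_int.
  by rewrite -[w 0]subr0; exact: pos_scale_dir_int r0 ltr01 h d00.
rewrite -as1.
apply: (@torsion_push R (fun t => A (t, (s, 0))) (fun t => w (clamp 0 1 t)) n 0) => //.
  by apply: cAu; by [exact: continuous_const|exact: continuous_id].
move=> t t' ht.
have [r r0 hr] := hA0 t s; have [q q0 hq] := wdir t.
have [k hk] : exists k : R, Dt (clamp 0 1 t) (to_annulus (c s)) (c' s) =
    k *: Dt (clamp 0 1 t) (to_annulus (c s)) (chi R).
  have rq : r = r / q * q by rewrite divfK// gt_eqF.
  rewrite hr hq; case: (dir_half_int ht) => ->.
    by exists (r / q); rewrite scalerA -rq.
  by exists (- (r / q)); rewrite scalerA mulNr -rq scaleNr scalerN.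
(* Injectivity of the tangent map at time [t] pulls the collinearity back to the original vectors;
   linearity then pushes it to time [t']. *)
have ck' : c' s = k *: chi R.
  apply/eqP; rewrite -subr_eq0; apply/eqP; apply: (DI t).
  have := tangent_linear (c s) (dft _ (i01 t)).2.1 1 (- k) (c' s) (chi R).
  by rewrite !scale1r !scaleNr hk subrr.
have [r' r'0 hr'] := hA0 t' s; have [q' q'0 hq'] := wdir t'.
apply: (@dir_collinear _ _ _ (r'^-1 * (k * q'))).
rewrite -2!scalerA -hq'.
have -> : k *: Dt (clamp 0 1 t') (to_annulus (c s)) (chi R) =
    Dt (clamp 0 1 t') (to_annulus (c s)) (c' s).
  have := tangent_linear (c s) (dft _ (i01 t')).2.1 0 k 0 (chi R).
  by rewrite !scale0r !add0r ck'.
by rewrite hr' scalerA mulVf ?scale1r// gt_eqF.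
Qed.

(** * Periodic functions and non-wandering dynamics *)

Lemma periodic_int (R : realType) (g : R -> R) (d : R) : (forall s, g (s + 1) = g s + d) ->
  forall s k : R, k \is a Num.int -> g (s + k) = g s + k * d.
Proof.
move=> pg s k kint.
have pg2 x : (g (x + 1), 0) = (g x, 0) + (d, 0) :> R * R.
  by rewrite pg; congr pair; exact: esym (addr0 _).
exact: (congr1 fst (@periodic_shift_int R (fun s => (g s, 0)) d pg2 s k kint)).
Qed.

(** With [k] the integer part of [v - ph 0], the value [v] lies between [ph k] and [ph (k + 1)]. *)
Lemma shift_surj (R : realType) (ph : R -> R) : continuous ph ->
  (forall s, ph (s + 1) = ph s + 1) -> forall v, exists s, ph s = v.
Proof.
move=> cph pph v; pose k : R := (Num.floor (v - ph 0))%:~R.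
have phk := periodic_int pph.
have kint : k \is a Num.int by exact: intr_int.
have kv : k <= v - ph 0 by exact: ge_floor.
have vk : v - ph 0 < k + 1 by rewrite /k -[1]/(1%:~R) -intrD; exact: floorD1_gt.
apply: (@IVT_value R ph k (k + 1) v cph).
have hk : ph k = ph 0 + k by have := phk 0 k kint; rewrite add0r mulr1.
by rewrite pph hk; apply/andP; split; lra.
Qed.

Lemma circle_periodic (R : realType) (g : R -> R) : continuous g ->
  (forall s, g (s + 1) = g s) ->
  exists2 h : circle R -> R, continuous h & forall s, h (to_circle s) = g s.
Proof.
move=> cg pg.
have hE s : g (repr (to_circle s)) = g s.
  rewrite -[repr _](subrK s) addrC (@periodic_int _ _ 0) ?mulr0 ?addr0//.
    by move=> x; rewrite addr0.
  by apply/to_circleP; rewrite to_circle_repr.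
exists (g \o repr); last exact: hE.
by apply: continuous_circle; rewrite (_ : (fun _ => _) = g)//; apply/funext => s; exact: hE.
Qed.

(* The arc [{a <= n/2}] is pushed strictly inside itself, so what leaves it
   in one step never comes back. *)
Lemma nonwandering_angle (R : realType) (f : annulus R -> annulus R)
    (gamma : circle R -> annulus R) (ph a : R -> R) (n : R) :
  injective f -> continuous gamma -> injective gamma ->
  invariant_curve f gamma -> nonwandering_on f (range gamma) ->
  continuous ph -> (forall s, ph (s + 1) = ph s + 1) ->
  continuous a -> (forall s, a (s + 1) = a s) ->
  (forall s, gamma (to_circle (ph s)) = f (gamma (to_circle s))) ->
  (forall s, a s <= n / 2 -> a (ph s) < n / 2) ->
  forall s, a s != n / 2.
Proof.
move=> fi cg ig inv nw cph pph ca pa hph push s0; apply/eqP => as0.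
(* Otherwise a preimage of [s0] under [ph] would satisfy [a <= n / 2] and be pushed strictly below
   the level attained at [s0]. *)
have [s1 as1] : exists s, n / 2 < a s.
  apply/not_existsP => h; have [s sE] := shift_surj cph pph s0.
  by have /negP := h s; rewrite -leNgt => /push; rewrite sE as0 ltxx.
have cap := continuous_compose cph ca.
(* A parameter that enters the arc in one step. If [s1] does not, the sum [a s + a (ph s)] takes the
   value [n] somewhere; [push] rules out [a s <= n / 2] there, so the two terms lie on opposite
   sides of [n / 2]. *)
have [s' as' aps'] : exists2 s, n / 2 < a s & a (ph s) < n / 2.
  have [aps1|aps1] := ltP (a (ph s1)) (n / 2); first by exists s1.
  have := push s0; rewrite as0 lexx => /(_ isT) aps0.
  have [|s hs] := @IVT_value R (fun s => a s + a (ph s)) s0 s1 n (continuous_add ca cap).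
    by apply/andP; split; lra.
  have [asn|asn] := leP (a s) (n / 2); first by have := push s asn; lra.
  by exists s => //; lra.
have [aa caa haa] := circle_periodic ca pa.
have [bb cbb hbb] : exists2 h : circle R -> R, continuous h & forall s, h (to_circle s) =
    a (ph s).
  by apply: circle_periodic => // s; rewrite pph pa.
(* The complement of [C] consists of the parameters entering the arc in one step. On the curve, [V]
   below cuts out exactly their images under [f], a relatively open set. *)
pose C := [set x | aa x <= n / 2] `|` [set x | n / 2 <= bb x].
have cC : closed C.
  apply: closedU.
    by apply: (@closed_comp _ _ aa [set x | x <= n / 2]); [move=> z _; exact: caa|exact:
        closed_le].
  by apply: (@closed_comp _ _ bb [set x | n / 2 <= x]); [move=> z _; exact: cbb|exact:
      closed_ge].
have cfg : continuous (fun x => f (gamma x)).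
  apply: continuous_circle; rewrite (_ : (fun _ => _) = fun s => gamma (to_circle (ph s))).
    exact: (continuous_compose (continuous_compose cph (@continuous_to_circle R)) cg).
  by apply/funext => s; rewrite hph.
pose V := ~` ((fun x => f (gamma x)) @` C).
have oV : open V by apply: closed_openC; exact: closed_curve_image.
have notC s : n / 2 < a s -> a (ph s) < n / 2 -> ~ C (to_circle s).
  by move=> h1 h2 [/=|/=]; rewrite ?haa ?hbb leNgt ?h1 ?h2.
have [|N N1 [y [[z [[x _ zx] Vz] zy] [_ Vy]]]] := nw V oV.
  exists (f (gamma (to_circle s'))); split; first by exists (to_circle (ph s')).
  by move=> [x Cx /fi/ig xE]; apply: (notC s') => //; rewrite -xE.
have : range gamma z by exists x.
rewrite -inv => -[_ [x1 _ <-] zE].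
have nC : ~ C x1 by move=> h; apply: Vz; exists x1.
rewrite -[x1]to_circle_repr in zE nC; set t := repr x1 in zE nC.
have at1 : a (ph t) < n / 2.
  by rewrite ltNge; apply/negP => h; apply: nC; right; rewrite /= hbb.
have at2 k : a (iter k.+1 ph t) < n / 2 by elim: k => [|k ih] //=; apply: push; exact: ltW.
have itE k : iter k f z = f (gamma (to_circle (iter k ph t))).
  by elim: k => [|k ih] //=; rewrite ih hph.
(* The bound [N >= 1] matters: [iter N ph t] is in the arc, hence in [C], whereas [t] itself is not.
   So the return point lies in the image of [C], outside [V]. *)
apply: Vy; rewrite -zy itE; exists (to_circle (iter N ph t)) => //; left.
by rewrite /= haa; case: N N1 {zy} => // N _; exact: ltW.
Qed.

(** * Graphs *)

Lemma diff1_is_diff (R : realType) (F : R -> R) (p l : R) :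
  is_derive p 1 F l -> is_diff p F (fun h => h * l).
Proof.
move=> dF; have F_diff : differentiable F p by apply/derivable1_diffP; exact: ex_derive.
split => //; apply/funext => h.
by rewrite -[h in LHS]mulr1 linearZ/= -deriveE// derive_val.
Qed.

(** Some positive integer [n] satisfies [Y n = Y 0]. If [Y (z + 1) - Y z] never vanished it would
    keep one sign, and [Y] would be strictly monotone along the integers. *)
Lemma unit_step_period (R : realType) (Y : R -> R) (d : R) : continuous Y ->
  d \is a Num.int -> d != 0 -> (forall v, Y (v + d) = Y v) -> exists z, Y (z + 1) = Y z.
Proof.
move=> cY /intrP[m ->] m0 pY.
have [n n0 Yn] : exists2 n : nat, (0 < n)%N & Y n%:R = Y 0.
  case: m m0 pY => [n|n] m0 pY; [exists n|exists n.+1 => //].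
  - by move: m0; rewrite intr_eq0; case: n pY.
  - by have := pY 0; rewrite add0r.
  - by rewrite -(pY n.+1%:R) NegzE mulrNz subrr.
apply: contrapT => /forallNP Y1.
pose h z := Y (z + 1) - Y z.
have ch : continuous h.
  apply: continuous_sub => //; apply: (continuous_compose _ cY (f := fun z : R => z + 1)).
  by apply: continuous_add; [exact: continuous_id|exact: continuous_const].
have h0 z : h z != 0 by rewrite subr_eq0; apply/eqP/Y1.
have hn (k : nat) : Y k.+1%:R = h k%:R + Y k%:R by rewrite /h natr1 subrK.
have [h00|h00] : 0 < h 0 \/ h 0 < 0 by have := h0 0; case: (ltgtP (h 0) 0); auto.
- have hp z : 0 < h z.
    rewrite ltNge; apply/negP => hz; have [|w /eqP] := @IVT_value R h z 0 0 ch.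
      by rewrite hz ltW.
    exact/negP/h0.
  suff : Y 0 < Y n%:R by rewrite Yn ltxx.
  case: n n0 {Yn} => // n _; elim: n => [|n ih]; rewrite hn; last by have := hp n.+1%:R;
      lra.
  by have := hp 0; lra.
- have hp z : h z < 0.
    rewrite ltNge; apply/negP => hz; have [|w /eqP] := @IVT_value R h 0 z 0 ch.
      by rewrite hz andbT ltW.
    exact/negP/h0.
  suff : Y n%:R < Y 0 by rewrite Yn ltxx.
  case: n n0 {Yn} => // n _; elim: n => [|n ih]; rewrite hn; last by have := hp n.+1%:R;
      lra.
  by have := hp 0; lra.
Qed.

Lemma int_mul_eq1 (R : realType) (k d : R) : k \is a Num.int -> d \is a Num.int ->
  k * d = 1 -> d = 1 \/ d = -1.
Proof.
move=> /intrP[m ->] /intrP[n ->]; rewrite -intrM -[1]/(1%:~R) => /intr_inj mn.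
have /eqP : (`|m| * `|n|)%N = 1%N by rewrite -abszM mn.
rewrite muln_eq1 => /andP[_ /eqP n1]; have : n = 1 \/ n = -1 by lia.
by case=> ->; [left|right].
Qed.

Lemma graph_of_transverse (R : realType) (gamma : circle R -> annulus R)
    (c c' : R -> R * R) (d : R) :
  injective gamma -> continuous c -> continuous c' -> d \is a Num.int -> d != 0 ->
  (forall s, to_annulus (c s) = gamma (to_circle s)) ->
  (forall s : R, exists2 D, is_diff s c D & D 1 = c' s) ->
  (forall s, (c' s).1 != 0) ->
  (forall s, c (s + 1) = c s + (d, 0)) -> (forall s, c' (s + 1) = c' s) ->
  exists2 psi : circle R -> R, C1_circle_function psi &
    range gamma = [set (x, psi x) | x in setT].
Proof.
move=> ig cc cc' dint d0 hc dc c'0 pc pc'.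
pose x s := (c s).1; pose y s := (c s).2.
have cx : continuous x := continuous_compose cc (@continuous_fst _ _).
have dx (s : R) : is_derive s 1 x (c' s).1.
  by have [D dD <-] := dc s; exact: is_diff_derive1 dD.
have dy (s : R) : is_derive s 1 y (c' s).2.
  by have [D dD <-] := dc s; exact: is_diff_derive2 dD.
(* Rolle's argument: the first coordinate has nowhere vanishing derivative. *)
have xlt s t : s < t -> x s != x t.
  move=> st; apply/eqP => xst.
  have [w _] := MVT st (fun s _ => dx s) (continuous_subspaceT cx).
  by rewrite xst subrr => /esym/eqP; rewrite mulf_eq0 (negbTE (c'0 w)) subr_eq0 gt_eqF.
have xinj : injective x.
  by move=> s t e; case: (ltgtP s t) => // /xlt; rewrite e eqxx.
have px s : x (s + 1) = x s + d by rewrite /x pc.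
have /choice[g gK] : forall v, exists s, x s = v.
  move=> v; have [|s|s hs] := @shift_surj R (fun s => x s / d) _ _ (v / d).
  - by apply: continuous_mul => //; exact: continuous_const.
  - by rewrite px mulrDl divff.
  - by exists s; exact: (mulIf (invr_neq0 d0)).
have xK : cancel x g by move=> s; apply: xinj; rewrite gK.
have dg (v : R) : is_derive v 1 g (c' (g v)).1^-1.
  rewrite -{1}(gK v); apply: (is_derive_inverse _ _ (dx (g v)) (c'0 (g v))).
  - by apply: (@filterE _ (nbhs (g v))) => s; exact: xK.
  - by apply: (@filterE _ (nbhs (g v))) => s; exact: cx.
have cg : continuous g.
  by move=> v; apply: differentiable_continuous; apply/derivable1_diffP; case: (dg v).
have pg v : g (v + d) = g v + 1 by apply: xinj; rewrite px !gK.
pose Y v := y (g v); pose Y' v := (c' (g v)).2 * (c' (g v)).1^-1.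
have dY (v : R) : is_derive v 1 Y (Y' v).
  exact: (@is_derive1_comp _ y g v _ _ (dy (g v)) (dg v)).
have cY : continuous Y.
  by move=> v; apply: differentiable_continuous; apply/derivable1_diffP; case: (dY v).
have cY' : continuous Y'.
  have cg1 := continuous_compose (continuous_compose cg cc') (@continuous_fst _ _).
  have cg2 := continuous_compose (continuous_compose cg cc') (@continuous_snd _ _).
  by apply: continuous_mul => // v; apply: cvgV; [exact: c'0|exact: cg1].
have pYd v : Y (v + d) = Y v by rewrite /Y pg /y pc; exact: addr0.
have pY'd v : Y' (v + d) = Y' v by rewrite /Y' pg pc'.
have cgv v : c (g v) = (v, Y v) by rewrite -{2}(gK v) /Y /x /y; case: (c _).
have d1 : d = 1 \/ d = -1.
  (* The points of abscissa [z] and [z + 1] project to one point of the annulus, so by injectivity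
     their parameters differ by an integer [k], and [k * d = 1]. *)
  have [z zY] := unit_step_period cY dint d0 pYd.
  have : to_annulus (c (g (z + 1))) = to_annulus (c (g z)).
    by apply/to_annulusP; rewrite !cgv/= zY addrAC subrr add0r rpred1.
  rewrite !hc => /ig/to_circleP kint; apply: (int_mul_eq1 kint dint).
  have := periodic_int px (g z) kint; rewrite [g z + _]addrC subrK !gK.
  by move/addrI.
have per1 (G : R -> R) : (forall v, G (v + d) = G v) -> forall v, G (v + 1) = G v.
  move=> pG v; case: d1 => dE; first by rewrite -[RHS](pG v) dE.
  by rewrite -(pG (v + 1)) dE addrK.
have [psi cpsi hpsi] := circle_periodic cY (per1 _ pYd).
have [E cE hE] := circle_periodic cY' (per1 _ pY'd).
exists psi.
  exists (fun x h => h * E x); split => [p|h]; last first.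
    by apply: continuous_mul => //; exact: continuous_const.
  exists Y; split; first by apply: (@filterE _ (nbhs p)) => q; rewrite hpsi.
  by rewrite hE; exact: diff1_is_diff.
apply/seteqP; split => [_ [X _ <-]|_ [X _ <-]].
  rewrite -[X]to_circle_repr -hc; set s := repr X.
  by exists (to_circle (x s)); rewrite // hpsi /Y xK.
exists (to_circle (g (repr X))) => //.
by rewrite -hc cgv -[in RHS](to_circle_repr X) hpsi.
Qed.

Theorem theorem1p2 (R : realType) (f : annulus R -> annulus R)
    (gamma : circle R -> annulus R) :
  negative_torsion_map f ->
  C1_essential_curve gamma ->
  invariant_curve f gamma ->
  nonwandering_on f (range gamma) ->
  exists2 psi : circle R -> R, C1_circle_function psi &
    range gamma = [set (x, psi x) | x in setT].
Proof.
move=> nt ess inv nw.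
have [c [c' [d [[cc cc' dint d0] hc dc c'0 per]]]] := curve_lift ess.
have [[cg ig _] _] := ess.
have [ph [a [[cph pph] [ca pa] hph c'a push]]] :=
  angle_dynamics nt inv cg ig cc cc' dint d0 hc dc c'0 (fun s => (per s).1).
apply: (graph_of_transverse ig cc cc' dint d0 hc dc) => [s|s|s];
  [|exact: (per s).1|exact: (per s).2].
have [[g [fK _ _ _]] _] := nt.
have [r r0 hr] := c'a s; apply/eqP => c1.
(* A vertical tangent has a half-integer angle, so the barrier to use is [n = 2 * a s], which [a]
   attains at [s]. *)
have aint : 2 * a s \is a Num.int.
  have d00 : dir (0 : R) = (0, 1) by rewrite dirE mulr0 sin0 cos0 oppr0.
  have : (dir (a s)).1 = 0.
    by have /eqP := c1; rewrite hr/= mulf_eq0 gt_eqF//= => /eqP.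
  rewrite -[a s]subr0 => h; apply: (@dir_collinear _ _ _ (dir (a s)).2).
  rewrite subr0 in h; rewrite d00; move: h; case: (dir (a s)) => u v/= ->.
  by congr pair; [change (0 = v * 0 :> R); rewrite mulr0|change (v = v * 1 :> R); rewrite
      mulr1].
have := nonwandering_angle (can_inj fK) cg ig inv nw cph pph ca pa hph
  (fun t => push t _ aint) s.
by rewrite mulrAC divff// mul1r eqxx.
Qed.
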